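(* Let $\mathcal{M}$ be a Riemannian manifold, let $f \colon \mathcal{M} \to \mathbb{R}$ be of class $\mathrm{C}^2$, let $\bar x$ be a local minimum of $f$, let $f_{\mathcal{S}} = f(\bar x)$ and $\mathcal{S} = \{x \in \mathcal{M} : x \text{ is a local minimum of } f \text{ and } f(x) = f_{\mathcal{S}}\}$. Suppose $f$ satisfies quadratic growth with constant $\mu > 0$ around $\bar x$: $f(x) - f_{\mathcal{S}} \geq \frac{\mu}{2}\mathrm{dist}(x, \mathcal{S})^2$ for all $x$ in some neighborhood of $\bar x$. Then for all $\mu^\flat < \mu$ and all $\lambda^\sharp > \lambda_{\max}(\nabla^2 f(\bar x))$ there exists a neighborhood $\mathcal{U}$ of $\bar x$ such that for all $x \in \mathcal{U}$, $$\mu^\flat\, \mathrm{dist}(x, \mathcal{S}) \leq \|\nabla f(x)\| \leq \lambda^\sharp\, \mathrm{dist}(x, \mathcal{S}).$$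
   Context: $\mathcal{M}$ is a smooth finite-dimensional Riemannian manifold with Riemannian distance $\mathrm{dist}$; $\nabla f$, $\nabla^2 f$ are the Riemannian gradient and Hessian; $\mathrm{dist}(x, \mathcal{S}) = \inf_{y \in \mathcal{S}} \mathrm{dist}(x, y)$; $\lambda_{\max}$ denotes the largest eigenvalue of a self-adjoint linear map. *)

(* Defs.v *)
From HB Require Import structures.
From mathcomp Require Import all_boot all_order all_algebra.
From mathcomp Require Import all_classical all_reals all_analysis.

Set Implicit Arguments.
Unset Strict Implicit.
Unset Printing Implicit Defensive.

Import Order.TTheory GRing.Theory Num.Theory.
Import numFieldNormedType.Exports.

Local Open Scope classical_set_scope.
Local Open Scope ring_scope.

(* Class C^k on [U], which is meant to be open: f has Frechet derivatives up to
   order k on U, and these are continuous. Quantifying over all directions v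
   amounts to quantifying over the standard basis. *)
Fixpoint Ck (R : realType) (n : nat) (W : normedModType R) (k : nat)
    (U : set 'rV[R]_n) (f : 'rV[R]_n -> W) : Prop :=
  if k is k'.+1 then
    (forall u, U u -> differentiable f u) /\ (forall v, Ck k' U ('D_v f))
  else forall u, U u -> {for u, continuous f}.

Definition smooth (R : realType) (n : nat) (W : normedModType R)
    (U : set 'rV[R]_n) (f : 'rV[R]_n -> W) : Prop :=
  forall k, Ck k U f.

(* [coord c] is only meaningful on [dom c], and its inverse [param c] only on
   [coord c @` dom c]; their values elsewhere are junk and never used. *)
Record smoothManifold (R : realType) (n : nat) := SmoothManifold {
  carrier :> topologicalType ;
  carrier_hausdorff : hausdorff_space carrier ;
  carrier_second_countable : @second_countable carrier ;
  chart : Type ;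
  dom : chart -> set carrier ;
  coord : chart -> carrier -> 'rV[R]_n ;
  param : chart -> 'rV[R]_n -> carrier ;
  dom_open : forall c, open (dom c) ;
  dom_cover : forall x, exists c, dom c x ;
  coord_image_open : forall c, open (coord c @` dom c) ;
  coordK : forall c x, dom c x -> param c (coord c x) = x ;
  coord_continuous : forall c x, dom c x -> {for x, continuous (coord c)} ;
  param_continuous : forall c u, (coord c @` dom c) u ->
    {for u, continuous (param c)} ;
  transition_smooth : forall c d,
    smooth (coord c @` (dom c `&` dom d)) (coord d \o param c)
}.

Arguments chart {R n} s.
Arguments dom {R n s} c _.
Arguments coord {R n s} c _.
Arguments param {R n s} c _.

Definition image_of (R : realType) (n : nat) (M : smoothManifold R n)
    (c : chart M) : set 'rV[R]_n := coord c @` dom c.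

Definition bform (R : realType) (n : nat) (G : 'M[R]_n) (v w : 'rV[R]_n) : R :=
  (v *m G *m w^T) 0 0.

(* [gmx c u] is the Gram matrix (g_ij) of the metric in the chart [c], at the
   point with coordinates [u]; [gmx_transition] says that these matrices are
   the local expressions of a single (0,2)-tensor field. *)
Record riemannianManifold (R : realType) (n : nat) := RiemannianManifold {
  manifold :> smoothManifold R n ;
  gmx : chart manifold -> 'rV[R]_n -> 'M[R]_n ;
  gmx_smooth : forall c, smooth (image_of c) (gmx c) ;
  gmx_sym : forall c u, image_of c u -> (gmx c u)^T = gmx c u ;
  gmx_posdef : forall c u v, image_of c u -> v != 0 -> 0 < bform (gmx c u) v v ;
  gmx_transition : forall c d x v w, dom c x -> dom d x ->
    bform (gmx c (coord c x)) v w =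
    bform (gmx d (coord d x)) ('d (coord d \o param c) (coord c x) v)
                              ('d (coord d \o param c) (coord c x) w)
}.

Arguments gmx {R n M} c u : rename.

Section Riemannian.
Variables (R : realType) (n : nat) (M : riemannianManifold R n).
Implicit Types (x y : M) (c : chart M) (u v : 'rV[R]_n) (f : M -> R).

(* The tangent space at x is represented by 'rV_n through the chart
   [chart_at x]; tangent vectors are row vectors, so that a linear
   endomorphism with matrix A acts by [v *m A]. *)
Definition chart_at x : chart M := projT1 (cid (dom_cover x)).

Definition tangent_norm x v : R :=
  Num.sqrt (bform (gmx (chart_at x) (coord (chart_at x) x)) v v).

Definition velocity (gamma : R -> M) (t : R) : 'rV[R]_n :=
  derive1 (coord (chart_at (gamma t)) \o gamma) t.

Definition C1_curve_at (gamma : R -> M) (t : R) : Prop :=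
  {for t, continuous gamma} /\
  forall c, dom c (gamma t) ->
    (\forall s \near t, derivable (coord c \o gamma) s 1) /\
    {for t, continuous (derive1 (coord c \o gamma))}.

(* On a closed interval, C^1 means: restriction of a C^1 curve defined on a
   larger open interval. *)
Definition C1_curve_on (gamma : R -> M) (a b : R) : Prop :=
  exists (delta : R -> M) (e : R),
    [/\ 0 < e,
        forall t, a - e < t < b + e -> C1_curve_at delta t &
        forall t, a <= t <= b -> gamma t = delta t].

Definition piecewise_C1 (gamma : R -> M) : Prop :=
  exists (k : nat) (s : nat -> R),
    [/\ s 0%N = 0, s k = 1 &
        forall i, (i < k)%N ->
          s i < s i.+1 /\ C1_curve_on gamma (s i) (s i.+1)].

(* The velocity may be junk at finitely many times, which is harmless. *)
Definition curve_length (gamma : R -> M) : \bar R :=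
  (\int[lebesgue_measure]_(t in `[0%R, 1%R])
    (tangent_norm (gamma t) (velocity gamma t))%:E)%E.

(* Equal to +oo between distinct connected components. *)
Definition rdist x y : \bar R :=
  ereal_inf [set curve_length gamma | gamma in
    [set gamma : R -> M |
      [/\ piecewise_C1 gamma, gamma 0 = x & gamma 1 = y]]].

Definition rdist_set x (S : set M) : \bar R := ereal_inf [set rdist x y | y in S].

Definition classC (k : nat) f : Prop :=
  forall c, Ck k (image_of c) (f \o param c).

Definition partial (i : 'I_n) (h : 'rV[R]_n -> R) : 'rV[R]_n -> R :=
  'D_(delta_mx 0 i) h.

(* grad f = df g^-1, i.e. g(grad f, w) = df(w) for all w. *)
Definition grad_in c f u : 'rV[R]_n :=
  (\row_i partial i (f \o param c) u) *m invmx (gmx c u).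

Definition grad f x : 'rV[R]_n :=
  grad_in (chart_at x) f (coord (chart_at x) x).

(* Christoffel symbol Gamma^k_ij of the Levi-Civita connection. *)
Definition christoffel c (i j k : 'I_n) u : R :=
  2^-1 * \sum_l invmx (gmx c u) k l *
    (partial i (fun w => gmx c w j l) u
     + partial j (fun w => gmx c w i l) u
     - partial l (fun w => gmx c w i j) u).

(* Covariant derivative at u, in direction v, of the vector field X. *)
Definition covd_in c (X : 'rV[R]_n -> 'rV[R]_n) u v : 'rV[R]_n :=
  'D_v X u + \row_k \sum_i \sum_j v 0 i * X u 0 j * christoffel c i j k u.

(* Matrix of the Riemannian Hessian v |-> nabla_v (grad f). *)
Definition hess f x : 'M[R]_n :=
  let c := chart_at x in lin1_mx (covd_in c (grad_in c f) (coord c x)).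

Definition lambda_max (A : 'M[R]_n) : R := sup [set a | eigenvalue A a].

Definition is_local_min f x : Prop := \forall y \near x, f x <= f y.

Definition local_min_set f x : set M :=
  [set y | is_local_min f y /\ f y = f x].

End Riemannian.

(* Main.v *)
(* Work in a chart at xbar; there the metric and the Hessian H of f are as close
   as we like to their values G and H at xbar, and grad f x is the dual vector of
   df, so that |grad f x| is the largest slope of f at x.

   For x near xbar pick y in S with rdist x y as close as we like to
   d = rdist_set x S, and let v be the difference of their coordinates. As df
   vanishes at y, the mean value theorem gives |grad f x| <= (lambda + o(1)) |v|,
   and a second order expansion gives 2 (f x - f y) <= df(x) v + o(|v|^2)
   <= |grad f x| |v| + o(|v|^2); as f x - f y >= mu/2 d^2 by quadratic growth and
   |v| <= (1 + o(1)) d, both bounds follow.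

   That |v| <= (1 + o(1)) rdist x y is the point where curves leaving the chart
   must be controlled: a C^1 function phi with compact support in the chart and
   slope at most C satisfies phi y - phi x <= C rdist x y for all x and y. This is
   applied to a bump, which shows that y lies in the chart, and to a linear form
   multiplied by a bump, which has slope at most 1 for the profile chosen here. *)

Require Import Defs.
From mathcomp Require Import all_boot all_order all_algebra.
From mathcomp Require Import all_classical all_reals all_analysis.
From mathcomp Require Import measurable_realfun ring lra.
(* Imported again so that [coord] is the chart and not [vector.coord]. *)
Require Import Defs.
Import Order.TTheory GRing.Theory Num.Theory.
Import numFieldNormedType.Exports.
Local Open Scope classical_set_scope.
Local Open Scope ring_scope.

Set Implicit Arguments.
Unset Strict Implicit.
Unset Printing Implicit Defensive.

(** * Symmetric bilinear forms and Rayleigh quotients *)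

(** No regularity of S is known and no point of S nearest to x is constructed: all estimates are
    made for some y in S with [rdist x y <= d + t], and only the final inequalities are passed to t
    = 0. Such a y is automatically close to [xbar], since [xbar] itself lies in S. In the lower
    bound, both 2 (f x - f y) and df(x) v are compared with the same number H(v, v), where H is
    frozen at [xbar], so that the leading terms cancel and only o(|v|^2) is left. Only the bound of
    |v| by the distance has to be sharp; conversely it is enough that the distance to [xbar] tends
    to 0. This sharpness is why the truncated linear form must have slope at most 1: a truncation
    losing a constant factor would spoil both final constants. *)

Section BilinearForms.
Variables (R : realType) (n : nat).
Implicit Types (G : 'M[R]_n) (u v w : 'rV[R]_n) (a : R).

Lemma bformE G v w :
  bform G v w = \sum_i \sum_j v 0 i * G i j * w 0 j.
Proof.
rewrite /bform mxE exchange_big /=; apply: eq_bigr => j _.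
by rewrite !mxE mulr_suml.
Qed.

Lemma bformDl G u v w : bform G (u + v) w = bform G u w + bform G v w.
Proof. by rewrite /bform !mulmxDl mxE. Qed.

Lemma bformDr G u v w : bform G w (u + v) = bform G w u + bform G w v.
Proof. by rewrite /bform linearD mulmxDr mxE. Qed.

Lemma bformZl G a v w : bform G (a *: v) w = a * bform G v w.
Proof. by rewrite /bform -!scalemxAl mxE. Qed.

Lemma bformZr G a v w : bform G v (a *: w) = a * bform G v w.
Proof. by rewrite /bform linearZ -scalemxAr mxE. Qed.

Lemma bformNl G v w : bform G (- v) w = - bform G v w.
Proof. by rewrite -scaleN1r bformZl mulN1r. Qed.

Lemma bformNr G v w : bform G v (- w) = - bform G v w.
Proof. by rewrite -scaleN1r bformZr mulN1r. Qed.

Lemma bformBl G u v w : bform G (u - v) w = bform G u w - bform G v w.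
Proof. by rewrite bformDl bformNl. Qed.

Lemma bformBr G u v w : bform G w (u - v) = bform G w u - bform G w v.
Proof. by rewrite bformDr bformNr. Qed.

Lemma bform0l G w : bform G 0 w = 0.
Proof. by rewrite -(scale0r 0) bformZl mul0r. Qed.

Lemma bform_mxB G1 G2 v w : bform (G1 - G2) v w = bform G1 v w - bform G2 v w.
Proof. by rewrite /bform mulmxBr mulmxBl !mxE. Qed.

Lemma bform_mxZ a G v w : bform (a *: G) v w = a * bform G v w.
Proof. by rewrite /bform -scalemxAr -scalemxAl mxE. Qed.

Lemma bformC G v w : G^T = G -> bform G v w = bform G w v.
Proof.
move=> sG; rewrite /bform -[v *m G *m w^T]trmxK mxE !trmx_mul trmxK sG.
by rewrite mulmxA.
Qed.

(** The quadratic polynomial [P] in t is nonnegative: take its minimiser, or, if [bform G w w = 0],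
    a point where the remaining affine function would be -1. Semidefinite forms must be covered,
    because the Hessian at a local minimum is no better. *)
Lemma bform_CS G v w : G^T = G -> (forall z, 0 <= bform G z z) ->
  bform G v w ^+ 2 <= bform G v v * bform G w w.
Proof.
move=> sG pG.
have P t : 0 <= bform G v v + 2 * t * bform G v w + t ^+ 2 * bform G w w.
  have := pG (v + t *: w).
  rewrite bformDl !bformDr !bformZl !bformZr (bformC w v sG).
  by congr (_ <= _); ring.
have := pG w; rewrite le_eqVlt => /predU1P[w0|w0].
  rewrite -w0 mulr0; have [->|b0] := eqVneq (bform G v w) 0.
    by rewrite expr0n.
  have := P (- (bform G v v + 1) / (2 * bform G v w)).
  rewrite -w0 mulr0 addr0.
  have -> : 2 * (- (bform G v v + 1) / (2 * bform G v w)) * bform G v w =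
    - (bform G v v + 1) by field.
  by rewrite opprD addrA subrr sub0r oppr_ge0 ler10.
have := P (- bform G v w / bform G w w).
have -> : bform G v v + 2 * (- bform G v w / bform G w w) * bform G v w +
    (- bform G v w / bform G w w) ^+ 2 * bform G w w =
    (bform G v v * bform G w w - bform G v w ^+ 2) / bform G w w.
  by field; rewrite gt_eqF.
by rewrite pmulr_lge0 ?invr_gt0// subr_ge0.
Qed.

Definition gnorm G v : R := Num.sqrt (bform G v v).

Lemma gnorm_ge0 G v : 0 <= gnorm G v.
Proof. exact: sqrtr_ge0. Qed.

Lemma sqr_gnorm G v : (forall z, 0 <= bform G z z) ->
  gnorm G v ^+ 2 = bform G v v.
Proof. by move=> pG; rewrite sqr_sqrtr. Qed.

Lemma gnormZ G a v : gnorm G (a *: v) = `|a| * gnorm G v.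
Proof.
by rewrite /gnorm bformZl bformZr mulrA -expr2 sqrtrM ?sqr_ge0// sqrtr_sqr.
Qed.

Lemma bform_le_gnorm G v w : G^T = G -> (forall z, 0 <= bform G z z) ->
  `|bform G v w| <= gnorm G v * gnorm G w.
Proof.
move=> sG pG; rewrite -(ler_pXn2r (ltn0Sn 1)) ?nnegrE//; last first.
  by rewrite mulr_ge0 ?gnorm_ge0.
by rewrite -normrX ger0_norm ?sqr_ge0// exprMn !sqr_gnorm//; exact: bform_CS.
Qed.

Lemma bform_psd_ker G v : G^T = G -> (forall z, 0 <= bform G z z) ->
  bform G v v = 0 -> v *m G = 0.
Proof.
move=> sG pG v0; apply/rowP => j; rewrite [RHS]mxE.
have : bform G v (delta_mx 0 j) ^+ 2 <= 0.
  by rewrite (le_trans (bform_CS _ _ sG pG))// v0 mul0r.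
rewrite le_eqVlt ltNge sqr_ge0 orbF sqrf_eq0 => /eqP <-.
by rewrite /bform trmx_delta -colE [RHS]mxE.
Qed.

Definition posdef G := forall v, v != 0 -> 0 < bform G v v.

Lemma posdef_psd G : posdef G -> forall z, 0 <= bform G z z.
Proof.
move=> pG z; have [->|/pG/ltW//] := eqVneq z 0.
by rewrite bform0l.
Qed.

Lemma posdef_unitmx G : posdef G -> G \in unitmx.
Proof.
move=> pG; rewrite -row_free_unit -kermx_eq0; apply/eqP/row_matrixP => i.
rewrite row0; apply/eqP; apply: contraT => /pG.
by rewrite /bform -row_mul mulmx_ker row0 mul0mx mxE ltxx.
Qed.

End BilinearForms.

Section BilinearFormsTopology.
Variables (R : realType) (n : nat).
Implicit Types (G H : 'M[R]_n) (u v w : 'rV[R]_n) (a : R).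

Lemma normr_coord_le m k (B : 'M[R]_(m, k)) i j : `|B i j| <= `|B|.
Proof.
rewrite [leRHS]/Num.Def.normr/= mx_normrE.
exact: (le_bigmax _ (fun ij => `|B ij.1 ij.2|) (i, j)).
Qed.

Lemma cvg_coord (T : Type) (S : set_system T) {FS : Filter S} (m k : nat)
    (A : T -> 'M[R]_(m, k)) (B : 'M[R]_(m, k)) i j :
  A @ S --> B -> (fun t => A t i j) @ S --> B i j.
Proof.
move=> AB.
exact: (cvg_comp _ _ AB (@matrix_normedtype.coord_continuous _ m k i j B)).
Qed.

Lemma cvg_bform (T : Type) (F : set_system T) {FF : Filter F}
    (g : T -> 'M[R]_n) (a b : T -> 'rV[R]_n) G v w :
  g @ F --> G -> a @ F --> v -> b @ F --> w ->
  (fun t => bform (g t) (a t) (b t)) @ F --> bform G v w.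
Proof.
move=> gG av bw.
rewrite [X in X @ _ --> _](_ : _ =
    fun t => \sum_i \sum_j a t 0 i * g t i j * b t 0 j); last first.
  by apply/funext => t; rewrite bformE.
rewrite bformE; apply: cvg_big => [|i _].
  exact: add_continuous.
apply: cvg_big => [|j _]; first exact: add_continuous.
by apply: cvgM; [apply: cvgM|]; exact: cvg_coord.
Qed.

Lemma continuous_bform G : continuous (fun v => bform G v v).
Proof.
move=> v; apply: (@cvg_bform _ (nbhs v) _ (fun=> G) id id).
- exact: (@cvg_cst 'M[R]_n).
- exact: cvg_id.
- exact: cvg_id.
Qed.

Lemma continuous_gnorm G : continuous (gnorm G).
Proof.
move=> v; apply: (@continuous_comp _ _ _ (fun z => bform G z z) Num.sqrt).
  exact: continuous_bform.
exact: sqrt_continuous.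
Qed.

Lemma bform_le_norm G v w : `|bform G v w| <= (n * n)%:R * `|G| * `|v| * `|w|.
Proof.
rewrite bformE (le_trans (ler_norm_sum _ _ _))//.
rewrite (@le_trans _ _ (\sum_(i < n) \sum_(j < n) `|G| * `|v| * `|w|))//.
  apply: ler_sum => i _; rewrite (le_trans (ler_norm_sum _ _ _))//.
  apply: ler_sum => j _; rewrite !normrM (mulrC `|G|).
  by rewrite !ler_pM// ?mulr_ge0// ?normr_coord_le// ler_pM// normr_coord_le.
by rewrite !sumr_const !card_ord -mulrnA -[leLHS]mulr_natl !mulrA.
Qed.

Lemma compact_sphere : compact [set v : 'rV[R]_n | `|v| = 1].
Proof.
apply: bounded_closed_compact.
  exists 1; split; first exact: num_real.
  by move=> x x1 v /= ->; exact: ltW.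
apply: (preimage_closed _ (@closed_eq R 1)) => v _.
exact: norm_continuous.
Qed.

Lemma sphere_scale v : v != 0 -> `| `|v|^-1 *: v | = 1.
Proof.
by move=> v0; rewrite normrZ normfV normr_id mulVf// normr_eq0.
Qed.

Lemma posdef_lower_bound G : posdef G ->
  exists2 m, 0 < m & forall v, m * `|v| <= gnorm G v.
Proof.
move=> pG.
have [S0|] := pselect ([set v : 'rV[R]_n | `|v| = 1] !=set0); last first.
  (* The unit sphere is empty only in dimension 0, where any constant works. *)
  move=> S0; exists 1 => // v; have [->|v0] := eqVneq v 0.
    by rewrite normr0 mulr0 gnorm_ge0.
  by exfalso; apply: S0; exists (`|v|^-1 *: v); exact: sphere_scale.
have cq : {within [set v : 'rV[R]_n | `|v| = 1], continuous (gnorm G)}.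
  exact/continuous_subspaceT/continuous_gnorm.
have [c] := EVT_min_rV S0 compact_sphere cq.
rewrite inE /= => c1 cmin; exists (gnorm G c).
  rewrite sqrtr_gt0 pG// -normr_gt0 c1; exact: ltr01.
move=> v; have [->|v0] := eqVneq v 0.
  by rewrite normr0 mulr0 gnorm_ge0.
have := cmin (`|v|^-1 *: v).
rewrite inE /= sphere_scale// gnormZ normfV normr_id => /(_ erefl).
by rewrite ler_pdivlMl ?normr_gt0// mulrC.
Qed.

(* The maximal Rayleigh quotient [L] is an eigenvalue: [L G - H] is positive
   semidefinite and vanishes at a maximiser, which hence lies in its kernel. *)
Lemma rayleigh_eigenvalue G H : G^T = G -> posdef G -> H^T = H -> (0 < n)%N ->
  exists2 L, eigenvalue (H *m invmx G) L &
    forall v, bform H v v <= L * bform G v v.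
Proof.
move=> sG pG sH n0.
have S0 : [set v : 'rV[R]_n | `|v| = 1] !=set0.
  exists (`|delta_mx 0 (Ordinal n0) : 'rV[R]_n|^-1 *: delta_mx 0 (Ordinal n0)).
  apply: sphere_scale; apply/eqP => /rowP/(_ (Ordinal n0)).
  by rewrite !mxE !eqxx => /eqP; rewrite oner_eq0.
have cq : {within [set v : 'rV[R]_n | `|v| = 1],
    continuous (fun v => bform H v v / bform G v v)}.
  apply/subspace_continuousP => v /= v1.
  apply: cvg_within_filter; apply: cvgM.
    exact: continuous_bform.
  apply: cvgV; first by rewrite gt_eqF// pG// -normr_gt0 v1.
  exact: continuous_bform.
have [c] := EVT_max_rV S0 compact_sphere cq.
rewrite inE /= => c1 cmax; set L := bform H c c / bform G c c in cmax.
have c0 : c != 0 by rewrite -normr_gt0 c1.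
have HL v : bform H v v <= L * bform G v v.
  have [->|v0] := eqVneq v 0; first by rewrite !bform0l mulr0.
  have := cmax (`|v|^-1 *: v).
  rewrite inE /= sphere_scale// !bformZl !bformZr => /(_ erefl).
  have nv : `|v|^-1 != 0 by rewrite invr_eq0 normr_eq0.
  rewrite -mulf_div divff// mul1r -mulf_div divff// mul1r.
  by rewrite ler_pdivrMr// pG.
exists L => //; apply/eigenvalueP; exists c => //.
have K : c *m (L *: G - H) = 0.
  apply: bform_psd_ker.
  - by rewrite linearB linearZ /= sG sH.
  - by move=> z; rewrite bform_mxB bform_mxZ subr_ge0.
  - by rewrite bform_mxB bform_mxZ /L divfK ?subrr// gt_eqF// pG.
move: K; rewrite mulmxBr => /eqP; rewrite subr_eq0 => /eqP K.
by rewrite mulmxA -K -scalemxAr -scalemxAl mulmxK// posdef_unitmx.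
Qed.

(** Every eigenvalue of [H *m invmx G] is the Rayleigh quotient of its eigenvector, so the maximal
    quotient, itself an eigenvalue, bounds the whole spectrum and [sup] is a genuine supremum. *)
Lemma lambda_max_rayleigh G H : G^T = G -> posdef G -> H^T = H ->
    (forall v, 0 <= bform H v v) ->
  0 <= lambda_max (H *m invmx G) /\
  forall v, bform H v v <= lambda_max (H *m invmx G) * bform G v v.
Proof.
move=> sG pG sH pH.
have E a v : v *m (H *m invmx G) = a *: v -> v != 0 ->
    bform H v v = a * bform G v v.
  move=> va v0; have : v *m H = a *: (v *m G).
    by rewrite scalemxAl -va mulmxA mulmxKV// posdef_unitmx.
  by rewrite /bform => ->; rewrite -scalemxAl mxE.
have [n0|] := ltnP 0 n; last first.
  rewrite leqn0 => /eqP n0; have Z (v : 'rV[R]_n) : v = 0.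
    by apply/rowP => -[i ni]; exfalso; move: ni; rewrite n0.
  (* In dimension 0 there are no eigenvalues, and [sup] takes its default value 0 on the empty
     set. *)
  split; last by move=> v; rewrite (Z v) !bform0l mulr0.
  rewrite /lambda_max (_ : mkset _ = set0) ?sup0//.
  by rewrite -subset0 => a /eigenvalueP[v _]; rewrite (Z v) eqxx.
have [L Lev HL] := rayleigh_eigenvalue sG pG sH n0.
have L0 : 0 <= L.
  have /eigenvalueP[v va v0] := Lev.
  have := pH v; rewrite (E _ _ va v0) pmulr_lge0//; exact: pG.
have LM : L <= lambda_max (H *m invmx G).
  apply: ub_le_sup => //; exists L => a /= /eigenvalueP[v va v0].
  have := HL v; rewrite (E _ _ va v0) ler_pM2r//; exact: pG.
split; first exact: le_trans LM.
by move=> v; rewrite (le_trans (HL v))// ler_wpM2r// posdef_psd.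
Qed.

End BilinearFormsTopology.

(** * Second order calculus *)

Section LineDerivatives.
Variables (R : realType) (n : nat) (W : normedModType R).
Implicit Types (u v w z : 'rV[R]_n) (g : 'rV[R]_n -> W).

Lemma is_derive_line g w v (t : R) : differentiable g (w + t *: v) ->
  is_derive t 1 (fun s : R => g (w + s *: v)) ('D_v g (w + t *: v)).
Proof.
move=> dg.
have il : is_diff (t : R) (fun s : R => w + s *: v : 'rV[R]_n) (fun s : R => s *: v).
  apply: is_diff_eq; last by rewrite add0r.
have dl : differentiable (fun s : R => w + s *: v : 'rV[R]_n) t by [].
have dc : differentiable (g \o (fun s : R => w + s *: v)) t.
  by apply: differentiable_comp.
apply: DeriveDef; first exact: diff_derivable.
rewrite deriveE// diff_comp//= (deriveE v dg) diff_val scale1r //.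
Qed.

Lemma derive_coord g u v : differentiable g u ->
  'D_v g u = \sum_j v 0 j *: 'D_(delta_mx 0 j) g u.
Proof.
move=> dg; rewrite deriveE// {1}(row_sum_delta v) linear_sum.
by apply: eq_bigr => j _; rewrite linearZ deriveE.
Qed.

End LineDerivatives.

Lemma MVT_line (R : realType) (n : nat) (g : 'rV[R]_n -> R) w v (s : R) :
    0 < s -> (forall t, 0 <= t <= s -> differentiable g (w + t *: v)) ->
  exists2 c, 0 <= c <= s & g (w + s *: v) - g w = s * 'D_v g (w + c *: v).
Proof.
move=> s0 dg.
have D (t : R) : 0 <= t <= s ->
    is_derive t 1 (fun t : R => g (w + t *: v)) ('D_v g (w + t *: v)).
  by move=> ts; apply: is_derive_line; exact: dg.
have [|||c cs] := @MVT R (fun t => g (w + t *: v)) (fun t => 'D_v g (w + t *: v)) 0 s.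
- by [].
- by move=> t; rewrite in_itv/= => /andP[/ltW t0 /ltW ts]; apply: D; rewrite t0.
- apply: derivable_within_continuous => t; rewrite in_itv/= => ts.
  exact: (@ex_derive _ _ _ _ _ _ _ (D _ ts)).
rewrite scale0r addr0 subr0 mulrC => ->; exists c => //.
by move: cs; rewrite in_itv/= => /andP[/ltW -> /ltW ->].
Qed.
(** The coordinate Hessian, without the Christoffel terms of [hess]; [hess_critical] relates the
    two. *)
Definition hessian (R : realType) (n : nat) (F : 'rV[R]_n -> R) u : 'M[R]_n :=
  \matrix_(i, j) 'D_(delta_mx 0 i) ('D_(delta_mx 0 j) F) u.

Lemma cvg_mx_coord (R : realType) (T : Type) (S : set_system T) {FS : Filter S}
    (m k : nat) (f : T -> 'M[R]_(m, k)) (B : 'M[R]_(m, k)) :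
  (forall i j, (fun t => f t i j) @ S --> B i j) -> f @ S --> B.
Proof.
move=> fB; apply/cvgrPdist_le => /= e e0; near=> t.
rewrite [leLHS]/Num.Def.normr/= mx_normrE (bigmax_le _ (ltW e0))//= => i _.
rewrite !mxE; move: i; near: t; apply: filter_forall => /= i.
exact: ((cvgrPdist_le _ _).1 (fB i.1 i.2)).
Unshelve. all: by end_near. Qed.

Section C2.
Variables (R : realType) (n : nat) (U : set 'rV[R]_n) (F : 'rV[R]_n -> R).
Hypotheses (U_open : open U) (F_C2 : Ck 2 U F).
Implicit Types (u v w z : 'rV[R]_n).

Lemma C2_differentiable u : U u -> differentiable F u.
Proof. exact: F_C2.1. Qed.

Lemma C2_differentiable_derive v u : U u -> differentiable ('D_v F) u.
Proof. exact: (F_C2.2 v).1. Qed.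

Lemma near_open u : U u -> \forall x \near u, U x.
Proof. by move=> Uu; apply: open_nbhs_nbhs. Qed.

Lemma hessianE u v w : U u -> 'D_v ('D_w F) u = bform (hessian F u) v w.
Proof.
move=> Uu; rewrite (derive_coord v (C2_differentiable_derive w Uu)) bformE.
apply: eq_bigr => i _.
have -> : 'D_(delta_mx 0 i) ('D_w F) u =
    'D_(delta_mx 0 i) (\sum_j (w 0 j \*: 'D_(delta_mx 0 j) F)) u.
  apply: near_eq_derive; near=> x.
  rewrite fct_sumE derive_coord//; apply: C2_differentiable.
  by near: x; exact: near_open.
rewrite derive_sum; last first.
  by move=> j; apply/derivableZ/diff_derivable/C2_differentiable_derive.
rewrite scaler_sumr; apply: eq_bigr => j _; rewrite deriveZ; last first.
  exact/diff_derivable/C2_differentiable_derive.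
by rewrite mxE -[LHS]/(v 0 i * (w 0 j * _)); ring.
Unshelve. all: by end_near. Qed.

Lemma hessian_continuous u : U u -> {for u, continuous (hessian F)}.
Proof.
move=> Uu; apply: (@cvg_mx_coord _ _ (nbhs u)) => i j.
rewrite (_ : (fun t => _) = 'D_(delta_mx 0 i) ('D_(delta_mx 0 j) F)).
  by rewrite mxE; exact: (F_C2.2 _).2.
by apply/funext => x; rewrite mxE.
Qed.

Let secdiff u v w (s : R) :=
  F (u + s *: v + s *: w) - F (u + s *: v) - F (u + s *: w) + F u.

(** Two applications of the mean value theorem, along w and then along v, turn the second difference
    into s^2 times a mixed derivative at a nearby point. As [secdiff] is symmetric in v and w, both
    mixed derivatives are limits of the same quotient, which gives [derive_derive_sym]. *)
Let secdiff_derive u v w : U u ->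
  forall e, 0 < e -> \forall s \near 0^'+,
    `|secdiff u v w s - s ^+ 2 * 'D_v ('D_w F) u| <= s ^+ 2 * e.
Proof.
move=> Uu e e0.
have : \forall x \near u, U x /\
    `|'D_v ('D_w F) u - 'D_v ('D_w F) x| <= e.
  apply: filterI; first exact: near_open.
  by have /cvgrPdist_le := (F_C2.2 w).2 v u Uu; apply.
move=> /nbhs_normP[r /= r0 rP].
near=> s.
have s0 : 0 < s by near: s; exact: nbhs_right_gt.
have B (a b : R) : 0 <= a <= s -> 0 <= b <= s ->
    U (u + a *: v + b *: w) /\
    `|'D_v ('D_w F) u - 'D_v ('D_w F) (u + a *: v + b *: w)| <= e.
  move=> /andP[a0 as_] /andP[b0 bs]; apply: rP => /=.
  rewrite -addrA opprD addrA subrr sub0r normrN.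
  rewrite (le_lt_trans (ler_normD _ _))// !normrZ !ger0_norm//.
  rewrite (@le_lt_trans _ _ (s * (`|v| + `|w| + 1)))//.
    rewrite mulrDr mulr1 mulrDr -addrA lerD ?ler_wpM2r//.
    by rewrite ler_wpDr ?ler_wpM2r// ltW.
  rewrite -ltr_pdivlMr; first by near: s; apply: nbhs_right_lt;
    rewrite divr_gt0// ltr_wpDl ?addr_ge0.
  by rewrite ltr_wpDl ?addr_ge0.
have D (t : R) : 0 <= t <= s ->
    is_derive t 1 (fun t : R => F (u + s *: v + t *: w) - F (u + t *: w))
      ('D_w F (u + s *: v + t *: w) - 'D_w F (u + t *: w)).
  move=> ts; apply: is_deriveB.
    apply: is_derive_line; apply: C2_differentiable.
    by apply: (B _ _ _ ts).1; rewrite lexx ltW.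
  apply: is_derive_line; apply: C2_differentiable.
  by rewrite -[u]addr0 -(scale0r v); apply: (B _ _ _ ts).1; rewrite lexx ltW.
have [|||c cs E1] := @MVT R
  (fun t => F (u + s *: v + t *: w) - F (u + t *: w))
  (fun t => 'D_w F (u + s *: v + t *: w) - 'D_w F (u + t *: w)) 0 s.
- by [].
- by move=> t; rewrite in_itv/= => /andP[/ltW t0 /ltW ts]; apply: D; rewrite t0.
- apply: derivable_within_continuous => t; rewrite in_itv/= => ts.
  exact: (@ex_derive _ _ _ _ _ _ _ (D _ ts)).
have {}cs : 0 <= c <= s.
  by move: cs; rewrite in_itv/= => /andP[/ltW -> /ltW ->].
have [|d ds E2] := @MVT_line R n ('D_w F) (u + c *: w) v s s0.
  move=> t ts; apply: C2_differentiable_derive; rewrite addrAC.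
  exact: (B _ _ ts cs).1.
have -> : secdiff u v w s = s ^+ 2 * 'D_v ('D_w F) (u + d *: v + c *: w).
  move: E1; rewrite !(addrAC u (c *: w)) in E2.
  rewrite E2 !scale0r !addr0 subr0 => E1.
  rewrite /secdiff; transitivity (F (u + s *: v + s *: w) - F (u + s *: w) -
    (F (u + s *: v) - F u)); first by ring.
  by rewrite E1; ring.
rewrite -mulrBr normrM ger0_norm ?sqr_ge0// ler_wpM2l ?sqr_ge0//.
by rewrite distrC; exact: (B _ _ ds cs).2.
Unshelve. all: by end_near. Qed.

Lemma derive_derive_sym u v w : U u -> 'D_v ('D_w F) u = 'D_w ('D_v F) u.
Proof.
move=> Uu; apply/eqP; rewrite -subr_eq0 -normr_le0; apply/ler_addgt0Pl => e e0.
rewrite addr0.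
have e20 : 0 < e / 2 by rewrite divr_gt0.
have [s [s0 [A B]]] := @filter_ex _ (nbhs (0 : R)^'+) _ _
  (filterI (nbhs_right_gt 0)
    (filterI (secdiff_derive v w Uu e20) (secdiff_derive w v Uu e20))).
rewrite -(@ler_pM2l _ (s ^+ 2)) ?exprn_gt0//.
rewrite -{1}[s ^+ 2]ger0_norm ?sqr_ge0// -normrM.
have -> : s ^+ 2 * ('D_v ('D_w F) u - 'D_w ('D_v F) u) =
    (secdiff u w v s - s ^+ 2 * 'D_w ('D_v F) u) -
    (secdiff u v w s - s ^+ 2 * 'D_v ('D_w F) u).
  rewrite /secdiff (addrAC u (s *: w)).
  by move: ('D_v _ u) ('D_w _ u) => a b; ring.
apply: (le_trans (ler_normB _ _)); rewrite [in leRHS](splitr e) mulrDr.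
exact: lerD B A.
Qed.

Lemma hessian_sym u : U u -> (hessian F u)^T = hessian F u.
Proof.
by move=> Uu; apply/matrixP => i j; rewrite !mxE derive_derive_sym.
Qed.

Section Segment.
Variables w v : 'rV[R]_n.
Hypothesis seg : forall t : R, 0 <= t <= 1 -> U (w + t *: v).
Hypothesis crit : 'D_v F w = 0.

(** Along the segment, F minus (K / 2) t^2 has nonpositive slope: at c this slope is c times the
    excess over K of a second derivative at some earlier point, because the first derivative
    vanishes at t = 0. *)
Lemma taylor_le (K : R) :
    (forall t, 0 <= t <= 1 -> 'D_v ('D_v F) (w + t *: v) <= K) ->
  F (w + v) - F w <= K / 2.
Proof.
move=> HK.
pose h (t : R) := F (w + t *: v) - (K / 2) * t ^+ 2.
have D (t : R) : 0 <= t <= 1 ->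
    is_derive t 1 h ('D_v F (w + t *: v) - K * t).
  move=> t01; apply: is_deriveB.
    by apply: is_derive_line; apply: C2_differentiable; exact: seg.
  apply: is_derive_eq. rewrite -[LHS]/(K / 2 * (t * 1 + t * 1)); lra.
have [|||c c01] := @MVT R h (fun t => 'D_v F (w + t *: v) - K * t) 0 1.
- exact: ltr01.
- by move=> t; rewrite in_itv/= => /andP[/ltW t0 /ltW ts]; apply: D; rewrite t0.
- apply: derivable_within_continuous => t; rewrite in_itv/= => ts.
  exact: (@ex_derive _ _ _ _ _ _ _ (D _ ts)).
rewrite /h !scale1r scale0r addr0 subr0 mulr1 expr1n expr0n/= mulr0 subr0 mulr1.
move: c01; rewrite in_itv/= => /andP[c0 c1].
have [|d /andP[d0 dc]] := @MVT_line R n ('D_v F) w v c c0.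
  move=> t /andP[t0 tc]; apply: C2_differentiable_derive; apply: seg.
  by rewrite t0 (le_trans tc)// ltW.
rewrite crit subr0 => -> E.
have : 'D_v ('D_v F) (w + d *: v) <= K.
  by apply: HK; rewrite d0 (le_trans dc)// ltW.
rewrite -(ler_pM2l c0); lra.
Qed.

(** The increment of F is at most (q + e) / 2, whereas the slope at the far end is at least q - e; q
    cancels. *)
Lemma taylor_critical (q e : R) :
    (forall t, 0 <= t <= 1 -> `|'D_v ('D_v F) (w + t *: v) - q| <= e) ->
  2 * (F (w + v) - F w) <= 'D_v F (w + v) + 2 * e.
Proof.
move=> Hq.
have : F (w + v) - F w <= (q + e) / 2.
  by apply: taylor_le => t /Hq; rewrite ler_distl => /andP[].
have [|d d01] := @MVT_line R n ('D_v F) w v 1 ltr01.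
  by move=> t t01; apply: C2_differentiable_derive; exact: seg.
rewrite crit scale1r mul1r subr0 => ->.
have := Hq _ d01; rewrite ler_distl => /andP[+ _]; lra.
Qed.

End Segment.

Section LocalMin.
Variable w : 'rV[R]_n.
Hypotheses (Uw : U w) (w_min : \forall x \near w, F w <= F x).

Lemma local_min_line v : \forall s \near (0 : R),
  U (w + s *: v) /\ F w <= F (w + s *: v).
Proof.
have L : (fun s : R => w + s *: v) @ (0 : R) --> w.
  rewrite -[in X in _ --> X](addr0 w) -(scale0r v).
  apply: cvgD; [exact: (@cvg_cst 'rV[R]_n)|].
  apply: cvgZr_tmp; exact: cvg_id.
exact: (L (fun x => U x /\ F w <= F x)) (filterI (near_open Uw) w_min).
Qed.

Lemma local_min_derive v : 'D_v F w = 0.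
Proof.
have /nbhs_normP[r /= r0 rP] := local_min_line v.
have rP' (t : R) : t \in `]- r, r[ -> U (w + t *: v) /\ F w <= F (w + t *: v).
  by rewrite in_itv/= => tr; apply: rP => /=; rewrite sub0r normrN ltr_norml.
have : is_derive (0 : R) 1 (fun t : R => F (w + t *: v)) 0.
  apply: (@derive1_at_min R _ (- r) r).
  - by rewrite (@le_trans _ _ 0)// ?oppr_le0 ltW.
  - move=> t /rP'[Ut _].
    exact: (@ex_derive _ _ _ _ _ _ _ (is_derive_line (C2_differentiable Ut))).
  - by rewrite in_itv/= r0 oppr_lt0 r0.
  - by move=> t /rP'[_]; rewrite scale0r addr0.
have D : is_derive (0 : R) 1 (fun t : R => F (w + t *: v)) ('D_v F (w + (0 : R) *: v)).
  by apply: is_derive_line; apply: C2_differentiable; rewrite scale0r addr0.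
move=> D0; have := @derive_val _ _ _ _ _ _ _ D0.
by rewrite (@derive_val _ _ _ _ _ _ _ D) scale0r addr0.
Qed.

Lemma local_min_hessian_ge0 v : 0 <= bform (hessian F w) v v.
Proof.
rewrite leNgt; apply/negP => a0; set a := bform _ v v in a0.
have : \forall x \near w, U x /\ bform (hessian F x) v v <= a / 2.
  apply: filterI; first exact: near_open.
  have : bform (hessian F x) v v @[x --> w] --> a.
    apply: (@cvg_bform _ _ _ (nbhs w) _ (hessian F) (fun=> v) (fun=> v)).
    - exact: hessian_continuous.
    - exact: (@cvg_cst 'rV[R]_n).
    - exact: (@cvg_cst 'rV[R]_n).
  by move=> /cvgr_le; apply; lra.
move=> /nbhs_normP[r /= r0 rP].
(* If the form were negative at v, it would stay below a / 2 near w, and a short step along v would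
   decrease F by at least s^2 |a| / 4. *)
near (0 : R)^'+ => s.
have s0 : 0 < s by near: s; exact: nbhs_right_gt.
have sr : s * (`|v| + 1) < r.
  rewrite -ltr_pdivlMr ?ltr_wpDl//; near: s; apply: nbhs_right_lt.
  by rewrite divr_gt0// ltr_wpDl.
have B (t : R) : 0 <= t <= 1 ->
    U (w + t *: (s *: v)) /\ bform (hessian F (w + t *: (s *: v))) v v <= a / 2.
  move=> /andP[t0 t1]; apply: rP => /=.
  rewrite opprD addrA subrr sub0r normrN !normrZ !ger0_norm// ?(ltW s0)//.
  rewrite (le_lt_trans _ sr)// (@le_trans _ _ (s * `|v|))//.
    by rewrite ler_piMl// mulr_ge0// ltW.
  by rewrite ler_wpM2l ?(ltW s0)// lerDl.
have : F (w + s *: v) - F w <= s ^+ 2 * (a / 2) / 2.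
  apply: taylor_le => [t /B[]//||t /B[Ut Ht]]; first exact: local_min_derive.
  rewrite hessianE// bformZl bformZr mulrA -expr2.
  by rewrite ler_wpM2l// sqr_ge0.
have : F w <= F (w + s *: v).
  by near: s; apply: cvg_within; apply: filterS (local_min_line v) => ? [].
have : s ^+ 2 * a < 0 by rewrite pmulr_rlt0// exprn_gt0.
lra.
Unshelve. all: by end_near. Qed.

End LocalMin.

End C2.

(** * Chart independence of speeds and gradients *)

Section Charts.
Variables (R : realType) (n : nat) (M : smoothManifold R n).
Implicit Types (x y : M) (c d : chart M) (u v w : 'rV[R]_n).

Lemma image_of_open c : open (image_of c).
Proof. exact: coord_image_open. Qed.

Lemma image_of_coord c x : dom c x -> image_of c (coord c x).
Proof. by move=> cx; exists x. Qed.

Lemma dom_param c u : image_of c u -> dom c (param c u).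
Proof. by move=> [x cx <-]; rewrite coordK. Qed.

Lemma paramK c u : image_of c u -> coord c (param c u) = u.
Proof. by move=> [x cx <-]; rewrite coordK. Qed.

Lemma near_dom c x : dom c x -> \forall y \near x, dom c y.
Proof. by move=> cx; apply: open_nbhs_nbhs; split => //; exact: dom_open. Qed.

Lemma near_image_of c u : image_of c u -> \forall w \near u, image_of c w.
Proof. by move=> cu; apply: open_nbhs_nbhs; split => //; exact: image_of_open. Qed.

Lemma overlap_open c d : open (coord c @` (dom c `&` dom d)).
Proof.
rewrite openE => _ [x [cx dx] <-].
have cux : image_of c (coord c x) by exact: image_of_coord.
have := @param_continuous R n M c _ cux (dom d).
rewrite coordK// => /(_ (near_dom dx)) H.
rewrite /interior; near=> u.
have cu : image_of c u by near: u; exact: near_image_of.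
exists (param c u); last exact: paramK.
by split; [exact: dom_param|near: u; exact: H].
Unshelve. all: by end_near. Qed.

Lemma transition_differentiable c d x : dom c x -> dom d x ->
  differentiable (coord d \o param c) (coord c x).
Proof.
by move=> cx dx; apply: (@transition_smooth R n M c d 1%N).1; exists x.
Qed.

Lemma transition_derive_continuous c d x v : dom c x -> dom d x ->
  {for coord c x, continuous ('D_v (coord d \o param c))}.
Proof.
by move=> cx dx; apply: (@transition_smooth R n M c d 1%N).2; exists x.
Qed.

Lemma near_dom_curve c (gamma : R -> M) (t : R) :
  {for t, continuous gamma} -> dom c (gamma t) ->
  \forall s \near t, dom c (gamma s).
Proof. by move=> ct ctx; apply: ct; exact: near_dom. Qed.

Lemma curve_transition c d (gamma : R -> M) (t : R) :
    {for t, continuous gamma} -> dom c (gamma t) -> dom d (gamma t) ->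
    derivable (coord c \o gamma) t 1 ->
  is_derive t 1 (coord d \o gamma)
    ('d (coord d \o param c) (coord c (gamma t)) (derive1 (coord c \o gamma) t)).
Proof.
move=> ct cx dx /derivable1_diffP dc.
have dphi := transition_differentiable cx dx.
apply: (@near_eq_is_derive _ _ _ ((coord d \o param c) \o (coord c \o gamma))).
  near=> s; rewrite /= coordK//; near: s; exact: near_dom_curve.
have dcomp : differentiable ((coord d \o param c) \o (coord c \o gamma)) t.
  exact: differentiable_comp.
apply: DeriveDef; first exact: diff_derivable.
by rewrite deriveE// diff_comp//= derive1E (deriveE (1 : R) dc).
Unshelve. all: by end_near. Qed.

End Charts.

Section Metric.
Variables (R : realType) (n : nat) (M : riemannianManifold R n).
Implicit Types (x y : M) (c d : chart M) (u v w : 'rV[R]_n).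

Lemma chart_atP x : dom (chart_at x) x.
Proof. exact: projT2 (cid (dom_cover x)). Qed.

Lemma gmx_continuous c u : image_of c u -> {for u, continuous (gmx c)}.
Proof. exact: (@gmx_smooth R n M c 0%N u). Qed.

Lemma posdef_gmx c u : image_of c u -> posdef (gmx c u).
Proof. by move=> cu v; exact: gmx_posdef. Qed.

Definition speed (gamma : R -> M) (t : R) : R :=
  tangent_norm (gamma t) (velocity gamma t).

(** [velocity] is read in [chart_at (gamma t)], which may jump with t. Invariance of the metric
    allows a whole stretch of the curve to be read in one fixed chart, as continuity of the speed
    requires. *)
Lemma speedE c (gamma : R -> M) (t : R) :
    {for t, continuous gamma} -> dom c (gamma t) ->
    derivable (coord c \o gamma) t 1 ->
  speed gamma t =
    gnorm (gmx c (coord c (gamma t))) (derive1 (coord c \o gamma) t).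
Proof.
move=> ct cx dc; rewrite /speed /tangent_norm /velocity /gnorm.
set d := chart_at (gamma t).
have dx : dom d (gamma t) by exact: chart_atP.
rewrite (gmx_transition _ _ cx dx) [in LHS]derive1E.
by rewrite (@derive_val _ _ _ _ _ _ _ (curve_transition ct cx dx dc)).
Qed.

Lemma speed_continuous (gamma : R -> M) (t : R) :
  (\forall s \near t, C1_curve_at gamma s) -> {for t, continuous (speed gamma)}.
Proof.
move=> C1; have [ct Ct] := nbhs_singleton C1.
pose c := chart_at (gamma t); have cx : dom c (gamma t) by exact: chart_atP.
have [dc dcont] := Ct c cx.
have E : \forall s \near t, speed gamma s =
    gnorm (gmx c (coord c (gamma s))) (derive1 (coord c \o gamma) s).
  near=> s; apply: speedE.
  - by have [] : C1_curve_at gamma s by near: s.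
  - near: s; exact: near_dom_curve.
  - by near: s.
rewrite /prop_for /continuous_at (nbhs_singleton E).
apply: cvg_trans; first apply: near_eq_cvg.
  by apply: filterS E => s ->; reflexivity.
apply: (@continuous_cvg _ _ _ (nbhs t) _ _ Num.sqrt); first exact: sqrt_continuous.
have ccont : {for t, continuous (coord c \o gamma)}.
  by apply: continuous_comp => //; exact: coord_continuous.
apply: (@cvg_bform _ _ _ (nbhs t)).
- apply: (@continuous_comp _ _ _ (coord c \o gamma) (gmx c)) => //.
  by apply: gmx_continuous; exact: image_of_coord.
- exact: dcont.
- exact: dcont.
Unshelve. all: by end_near. Qed.

Section Gradient.
Variables (f : M -> R) (f_C2 : classC 2 f).

Lemma grad_inP c u z : image_of c u ->
  bform (gmx c u) (grad_in c f u) z = 'D_z (f \o param c) u.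
Proof.
move=> cu; have df := C2_differentiable (f_C2 c) cu.
rewrite /bform /grad_in mulmxKV ?posdef_unitmx//; last exact: posdef_gmx.
rewrite (derive_coord _ df) mxE; apply: eq_bigr => j _.
by rewrite !mxE mulrC.
Qed.

Lemma derive_transition c d x v : dom c x -> dom d x ->
  'D_v (f \o param c) (coord c x) =
  'D_('d (coord d \o param c) (coord c x) v) (f \o param d) (coord d x).
Proof.
move=> cx dx.
have dphi := transition_differentiable cx dx.
have Ed : (coord d \o param c) (coord c x) = coord d x by rewrite /= coordK.
have dfd : differentiable (f \o param d) ((coord d \o param c) (coord c x)).
  by rewrite Ed; apply: (C2_differentiable (f_C2 d)); exact: image_of_coord.
rewrite (@near_eq_derive _ _ _ _ ((f \o param d) \o (coord d \o param c))); last first.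
  near=> u; rewrite /= coordK//.
  have : (coord c @` (dom c `&` dom d)) u.
    near: u; apply: open_nbhs_nbhs; split; first exact: overlap_open.
    by exists x.
  by move=> [y [cy dy] <-]; rewrite coordK.
rewrite deriveE; last exact: differentiable_comp.
by rewrite diff_comp//= coordK// [RHS]deriveE// -Ed.
Unshelve. all: by end_near. Qed.

(** If T is the differential of the transition and X, Y are the gradients in c and d, then |X|^2 =
    df(X) is the inner product of Y and T X in d, hence at most |Y| |T X| = |Y| |X|. Exchanging c
    and d gives equality. *)
Let gradnorm_le c d x : dom c x -> dom d x ->
  gnorm (gmx c (coord c x)) (grad_in c f (coord c x)) <=
  gnorm (gmx d (coord d x)) (grad_in d f (coord d x)).
Proof.
move=> cx dx; set a := gnorm _ _; set b := gnorm _ _.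
have cu := image_of_coord cx; have du := image_of_coord dx.
have pd := posdef_psd (posdef_gmx du); have pc := posdef_psd (posdef_gmx cu).
have : a ^+ 2 <= b * a.
  rewrite sqr_gnorm// grad_inP// (derive_transition _ cx dx) -grad_inP//.
  rewrite (le_trans (ler_norm _))// (le_trans (bform_le_gnorm _ _ _ pd))//.
    exact: gmx_sym.
  by rewrite [in leRHS]/a /gnorm (gmx_transition _ _ cx dx).
have [a0|a0] := ltP 0 a; first by rewrite expr2 ler_pM2r.
by move=> _; rewrite (le_trans a0)// gnorm_ge0.
Qed.

Lemma tangent_norm_gradE c x : dom c x ->
  tangent_norm x (grad f x) =
  gnorm (gmx c (coord c x)) (grad_in c f (coord c x)).
Proof.
move=> cx; have dx := chart_atP x; apply/eqP; rewrite eq_le.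
by apply/andP; split; exact: gradnorm_le.
Qed.

End Gradient.
End Metric.

(** * Comparison of the distance with a chart *)

Section TestFunction.
Variables (R : realType) (n : nat) (M : riemannianManifold R n).
Variables (c : chart M) (K : set 'rV[R]_n) (Phi : 'rV[R]_n -> R) (C : R).
Hypotheses (K_compact : compact K) (K_sub : K `<=` image_of c).
Hypothesis Phi_out : forall u, ~ K u -> Phi u = 0.
Hypothesis Phi_diff : forall u, image_of c u -> differentiable Phi u.
Hypothesis Phi_cont : forall v u, image_of c u -> {for u, continuous ('D_v Phi)}.
Hypothesis C_gt0 : 0 < C.
Hypothesis Phi_slope : forall u v, image_of c u ->
  'D_v Phi u <= C * gnorm (gmx c u) v.
Implicit Types (x y : M) (gamma delta : R -> M).

Definition extend0 x : R := if `[< dom c x >] then Phi (coord c x) else 0.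

Lemma extend0_dom x : dom c x -> extend0 x = Phi (coord c x).
Proof. by rewrite /extend0 => cx; rewrite asboolT. Qed.

(** The Hausdorff property enters here: a compact subset of the chart is closed in the manifold, so
    the extension by zero vanishes near every point outside the chart and stays C^1 along curves
    that leave it. *)
Lemma closed_param_image : closed (param c @` K).
Proof.
apply: compact_closed; first exact: carrier_hausdorff.
apply: continuous_compact => //.
by apply: continuous_in_subspaceT => u; rewrite inE => /K_sub; exact: param_continuous.
Qed.

Lemma extend0_near x : ~ dom c x -> \forall y \near x, extend0 y = 0.
Proof.
move=> cx; have xK : (~` (param c @` K)) x.
  by move=> [u /K_sub cu ux]; apply: cx; rewrite -ux; exact: dom_param.
have : \forall y \near x, (~` (param c @` K)) y.
  by apply: open_nbhs_nbhs; split => //; apply: closed_openC; exact: closed_param_image.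
apply: filterS => y yK; have [cy|cy] := pselect (dom c y); last first.
  by rewrite /extend0 asboolF.
rewrite extend0_dom// Phi_out// => Ku; apply: yK; exists (coord c y) => //.
exact: coordK.
Qed.

Lemma extend0_is_derive gamma (t : R) : {for t, continuous gamma} ->
    dom c (gamma t) -> derivable (coord c \o gamma) t 1 ->
  is_derive t 1 (extend0 \o gamma)
    ('D_(derive1 (coord c \o gamma) t) Phi (coord c (gamma t))).
Proof.
move=> ct cx /derivable1_diffP dc.
have dphi : differentiable Phi (coord c (gamma t)).
  by apply: Phi_diff; exact: image_of_coord.
apply: (@near_eq_is_derive _ _ _ (Phi \o (coord c \o gamma))).
  near=> s; rewrite /= extend0_dom//; near: s; exact: near_dom_curve.
have dcomp : differentiable (Phi \o (coord c \o gamma)) t.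
  exact: differentiable_comp.
apply: DeriveDef; first exact: diff_derivable.
by rewrite deriveE// diff_comp//= derive1E (deriveE (1 : R) dc) (deriveE _ dphi).
Unshelve. all: by end_near. Qed.

Lemma extend0_curve_out gamma (t : R) : {for t, continuous gamma} ->
  ~ dom c (gamma t) -> \forall s \near t, is_derive (s : R) 1 (extend0 \o gamma) 0.
Proof.
move=> ct cx; have := ct _ (extend0_near cx).
move=> /nbhs_interior; apply: filterS => s s0.
apply: (@near_eq_is_derive _ _ _ (cst (0 : R))).
by apply: filterS s0 => r /= ->.
Qed.

Lemma extend0_curve_derivable gamma (t : R) : C1_curve_at gamma t ->
  derivable (extend0 \o gamma) t 1.
Proof.
move=> [ct Ct]; have [cx|cx] := pselect (dom c (gamma t)).
  apply: (@ex_derive _ _ _ _ _ _ _ (extend0_is_derive ct cx _)).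
  by have [/nbhs_singleton] := Ct _ cx.
exact: (@ex_derive _ _ _ _ _ _ _ (nbhs_singleton (extend0_curve_out ct cx))).
Qed.

Lemma extend0_curve_le gamma (t : R) : C1_curve_at gamma t ->
  derive1 (extend0 \o gamma) t <= C * speed gamma t.
Proof.
move=> [ct Ct]; rewrite derive1E; have [cx|cx] := pselect (dom c (gamma t)).
  have [/nbhs_singleton dc _] := Ct _ cx.
  rewrite (@derive_val _ _ _ _ _ _ _ (extend0_is_derive ct cx dc)) (speedE ct cx dc).
  by apply: Phi_slope; exact: image_of_coord.
rewrite (@derive_val _ _ _ _ _ _ _ (nbhs_singleton (extend0_curve_out ct cx))).
by rewrite mulr_ge0// ?sqrtr_ge0// ltW.
Qed.

(** Continuity of this derivative is what the fundamental theorem of calculus asks for in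
    [piece_length]. *)
Lemma extend0_curve_continuous gamma (t : R) :
  (\forall s \near t, C1_curve_at gamma s) ->
  {for t, continuous (derive1 (extend0 \o gamma))}.
Proof.
move=> C1; have [ct Ct] := nbhs_singleton C1.
have [cx|cx] := pselect (dom c (gamma t)); last first.
  have E : \forall s \near t, derive1 (extend0 \o gamma) s = 0.
    apply: filterS (extend0_curve_out ct cx) => s D.
    by rewrite derive1E (@derive_val _ _ _ _ _ _ _ D).
  rewrite /prop_for /continuous_at (nbhs_singleton E).
  by apply: cvg_near_cst.
have [dc dcont] := Ct c cx.
have E : \forall s \near t, derive1 (extend0 \o gamma) s =
    \sum_j (derive1 (coord c \o gamma) s 0 j) * 'D_(delta_mx 0 j) Phi (coord c (gamma s)).
  near=> s.
  have cs : dom c (gamma s) by near: s; exact: near_dom_curve.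
  have D : is_derive s 1 (extend0 \o gamma)
      ('D_(derive1 (coord c \o gamma) s) Phi (coord c (gamma s))).
    apply: extend0_is_derive; [|exact: cs|by near: s].
    by have [] : C1_curve_at gamma s by near: s.
  rewrite derive1E (@derive_val _ _ _ _ _ _ _ D) derive_coord//.
  by apply: Phi_diff; exact: image_of_coord.
rewrite /prop_for /continuous_at (nbhs_singleton E).
apply: cvg_trans; first apply: near_eq_cvg.
  by apply: filterS E => s ->; reflexivity.
have ccont : {for t, continuous (coord c \o gamma)}.
  by apply: continuous_comp => //; exact: coord_continuous.
apply: cvg_big => [|j _]; first exact: add_continuous.
apply: cvgM.
  exact: cvg_coord dcont.
apply: (@continuous_comp _ _ _ (coord c \o gamma) ('D_(delta_mx 0 j) Phi)) => //.
by apply: Phi_cont; exact: image_of_coord.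
Unshelve. all: by end_near. Qed.

(** The endpoints are excluded: there the derivative of [gamma] also sees the neighbouring piece. *)
Lemma speed_congr gamma delta (a b : R) :
  (forall t, a <= t <= b -> gamma t = delta t) ->
  forall t, a < t < b -> speed gamma t = speed delta t.
Proof.
move=> E t /andP[at_ tb].
have N : \forall s \near t, gamma s = delta s.
  near=> s; apply: E; apply/andP; split; near: s.
    by apply: filterS (lt_nbhsr at_) => s; exact: ltW.
  by apply: filterS (lt_nbhsl tb) => s; exact: ltW.
rewrite /speed /velocity (nbhs_singleton N); congr (tangent_norm _ _).
rewrite !derive1E; apply: near_eq_derive.
by apply: filterS N => s /= ->.
Unshelve. all: by end_near. Qed.

Local Notation mu := (@lebesgue_measure R).

(** Half-open intervals make consecutive pieces disjoint. *)
Lemma piece_length gamma (a b : R) : a < b -> C1_curve_on gamma a b ->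
  measurable_fun `]a, b] (speed gamma) /\
  ((extend0 (gamma b) - extend0 (gamma a))%:E <=
    C%:E * \int[mu]_(t in `]a, b]) (speed gamma t)%:E)%E.
Proof.
move=> ab [delta [e [e0 Cd gd]]].
have near_C1 t : a <= t <= b -> \forall s \near t, C1_curve_at delta s.
  move=> /andP[at_ tb]; near=> s; apply: Cd; apply/andP; split; near: s.
    by apply: lt_nbhsr; rewrite (lt_le_trans _ at_)// ltrBlDr ltrDl.
  by apply: lt_nbhsl; rewrite (le_lt_trans tb)// ltrDl.
have spd : forall t, a <= t <= b -> {for t, continuous (speed delta)}.
  by move=> t /near_C1; exact: speed_continuous.
have Esp := speed_congr gd.
have mo : measurable_fun `]a, b[ (speed delta).
  apply: open_continuous_measurable_fun; first exact: interval_open.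
  move=> t; rewrite inE/= in_itv/= => /andP[/ltW at_ /ltW tb].
  by apply: spd; rewrite at_.
have mg : measurable_fun `]a, b[ (speed gamma).
  apply: eq_measurable_fun mo => t; rewrite inE/= in_itv/= => tab.
  by rewrite Esp.
split; first exact/measurable_fun_itv_bndo_bndcP.
(* The integrands agree on the open interval and the endpoints are negligible; from here on only the
   C^1 extension [delta] matters. *)
have -> : (\int[mu]_(t in `]a, b]) (speed gamma t)%:E =
    \int[mu]_(t in `[a, b]) (speed delta t)%:E)%E.
  apply: etrans (integral_itv_bndoo _ _ (proj2 (measurable_EFinP _ _) mg)) _.
  apply: etrans (esym (integral_itv_bndoo _ _ (proj2 (measurable_EFinP _ _) mo))).
  by apply: eq_integral => t; rewrite inE/= in_itv/= => tab; rewrite Esp.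
rewrite !gd ?lexx ?(ltW ab)//.
have cs : {within `[a, b], continuous (speed delta)}.
  apply: continuous_in_subspaceT => t; rewrite inE/= in_itv/= => tab.
  exact: spd.
have ch : {within `[a, b], continuous (derive1 (extend0 \o delta))}.
  apply: continuous_in_subspaceT => t; rewrite inE/= in_itv/= => tab.
  by apply: extend0_curve_continuous; exact: near_C1.
have dh t : a <= t <= b -> derivable (extend0 \o delta) t 1.
  by move=> tab; apply: extend0_curve_derivable; exact: nbhs_singleton (near_C1 t tab).
have hc t : a <= t <= b -> {for t, continuous (extend0 \o delta)}.
  by move=> /dh /derivable1_diffP; exact: differentiable_continuous.
have := @continuous_FTC2 R _ (extend0 \o delta) a b ab ch.
rewrite EFinB => <- //; last first.
  split.
  - by move=> t; rewrite in_itv/= => /andP[/ltW at_ /ltW tb]; apply: dh; rewrite at_.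
  - by apply: cvg_at_right_filter; apply: hc; rewrite lexx ltW.
  - by apply: cvg_at_left_filter; apply: hc; rewrite lexx ltW.
have is_ := continuous_compact_integrable (@segment_compact _ a b) cs.
have ih := continuous_compact_integrable (@segment_compact _ a b) ch.
rewrite -integralZl//; apply: le_integral => //; first exact: integrableZl.
move=> t; rewrite inE/= in_itv/= => tab.
rewrite -EFinM lee_fin; apply: extend0_curve_le; exact: nbhs_singleton (near_C1 t tab).
Unshelve. all: by end_near. Qed.

Lemma curve_length_ge0 gamma : (0 <= curve_length gamma)%E.
Proof. by apply: integral_ge0 => t _; rewrite lee_fin sqrtr_ge0. Qed.

Lemma extend0_curve_length gamma : piecewise_C1 gamma ->
  ((extend0 (gamma 1%R) - extend0 (gamma 0%R))%:E <= C%:E * curve_length gamma)%E.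
Proof.
move=> [k [s [s0 sk Hs]]].
(* Measurability is carried along the induction because additivity of the integral over the next
   piece requires it. *)
suff : forall i, (i <= k)%N ->
    (0 <= s i)%R /\ measurable_fun `[0, s i] (speed gamma) /\
    ((extend0 (gamma (s i)) - extend0 (gamma 0%R))%:E <=
      C%:E * \int[mu]_(t in `[0%R, s i]) (speed gamma t)%:E)%E.
  by move=> /(_ k (leqnn k)); rewrite sk => -[_ [_]].
elim=> [_|i IH ik].
  rewrite s0 subrr; split=> //; rewrite set_itv1; split; first exact: measurable_fun_set1.
  rewrite mule_ge0 ?lee_fin ?(ltW C_gt0)//.
  by apply: integral_ge0 => t _; rewrite lee_fin sqrtr_ge0.
have [si0 [mi Hi]] := IH (ltnW ik).
have [si C1i] := Hs i ik.
have [mi' Hi'] := piece_length si C1i.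
have U : `[0%R, s i.+1]%classic = `[0%R, s i]%classic `|` `]s i, s i.+1]%classic.
  by apply: itv_bndbnd_setU; rewrite bnd_simp// ltW.
have mU : measurable_fun (`[0%R, s i] `|` `]s i, s i.+1]) (speed gamma).
  by apply/measurable_funU.
split; first by rewrite (le_trans si0)// ltW.
split; first by rewrite U.
rewrite U ge0_integral_setU//; first last.
- rewrite disj_set2E; apply/eqP; rewrite -subset0 => t /=.
  by rewrite !in_itv/= => -[/andP[_ t1] /andP[t2 _]]; move: (lt_le_trans t2 t1); rewrite ltxx.
- by move=> t _; rewrite lee_fin sqrtr_ge0.
- exact/measurable_EFinP.
have I0 (A : set R) : (0 <= \int[mu]_(t in A) (speed gamma t)%:E)%E.
  by apply: integral_ge0 => t _; rewrite lee_fin sqrtr_ge0.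
rewrite ge0_muleDr//.
have -> : (extend0 (gamma (s i.+1)) - extend0 (gamma 0))%:E =
  ((extend0 (gamma (s i)) - extend0 (gamma 0))%:E +
  (extend0 (gamma (s i.+1)) - extend0 (gamma (s i)))%:E)%E.
  by rewrite -EFinD; congr EFin; ring.
exact: leeD.
Qed.

Lemma extend0_rdist x y :
  ((extend0 y - extend0 x)%:E <= C%:E * rdist x y)%E.
Proof.
rewrite muleC -lee_pdivrMr//.
apply: le_ereal_inf_tmp => _ [gamma [Cg g0 g1] <-].
rewrite lee_pdivrMr// muleC -g0 -g1; exact: extend0_curve_length.
Qed.
End TestFunction.

(** * Upper bound for the distance by coordinate segments *)

Section StraightLines.
Variables (R : realType) (n : nat) (M : riemannianManifold R n) (c : chart M).
Implicit Types (x y : M) (u v : 'rV[R]_n).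

Lemma line_continuous u v : continuous (fun t : R => u + t *: v).
Proof.
move=> t; apply: cvgD; first exact: (@cvg_cst 'rV[R]_n).
by apply: cvgZr_tmp; exact: cvg_id.
Qed.

Lemma near_line u v (t : R) : image_of c (u + t *: v) ->
  \forall s \near t, image_of c (u + s *: v).
Proof. by move=> cut; apply: line_continuous; exact: near_image_of. Qed.

Let gamma u v (t : R) : M := param c (u + t *: v).

Let gamma_continuous u v t : image_of c (u + t *: v) ->
  {for t, continuous (gamma u v)}.
Proof.
move=> cut; apply: (@continuous_comp _ _ _ (fun s : R => u + s *: v) (param c)).
  exact: line_continuous.
exact: param_continuous.
Qed.

Let gamma_derive u v (t : R) : image_of c (u + t *: v) ->
  is_derive t 1 (coord c \o gamma u v) v.
Proof.
move=> cut; apply: (@near_eq_is_derive _ _ _ (fun s : R => u + s *: v)).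
  by apply: filterS (near_line cut) => s cs; rewrite /= paramK.
have := @is_derive_line R n _ id u v t; rewrite derive_id; apply.
by apply: (@linear_differentiable _ _ _ idfun) => ? //.
Qed.

Let gamma_C1 u v (t : R) : image_of c (u + t *: v) -> C1_curve_at (gamma u v) t.
Proof.
move=> cut; split; first exact: gamma_continuous.
move=> d dx.
have cx : dom c (gamma u v t) by exact: dom_param.
have E : \forall s \near t, is_derive (s : R) 1 (coord d \o gamma u v)
    ('D_v (coord d \o param c) (u + s *: v)).
  have gt := gamma_continuous cut.
  near=> s.
  have cs : image_of c (u + s *: v) by near: s; exact: near_line.
  have ds : dom d (gamma u v s) by near: s; exact: near_dom_curve.
  have D := gamma_derive cs.
  have := curve_transition (gamma_continuous cs) (dom_param cs) ds
    (@ex_derive _ _ _ _ _ _ _ D).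
  rewrite derive1E (@derive_val _ _ _ _ _ _ _ D) -deriveE; last first.
    exact: transition_differentiable (dom_param cs) ds.
  by rewrite [coord c _]paramK.
split.
  by apply: filterS E => s D; exact: (@ex_derive _ _ _ _ _ _ _ D).
have E' : \forall s \near t, derive1 (coord d \o gamma u v) s =
    'D_v (coord d \o param c) (u + s *: v).
  by apply: filterS E => s D; rewrite derive1E (@derive_val _ _ _ _ _ _ _ D).
rewrite /prop_for /continuous_at (nbhs_singleton E').
apply: cvg_trans; first apply: near_eq_cvg.
  by apply: filterS E' => s ->; reflexivity.
apply: (@continuous_comp _ _ _ (fun s : R => u + s *: v) ('D_v (coord d \o param c))).
  exact: line_continuous.
rewrite -{1}(paramK cut); exact: transition_derive_continuous.
Unshelve. all: by end_near. Qed.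

Lemma rdist_line x y (L : R) : dom c x -> dom c y ->
    (forall t, 0 <= t <= 1 ->
      let z := coord c x + t *: (coord c y - coord c x) in
      image_of c z /\ gnorm (gmx c z) (coord c y - coord c x) <= L) ->
  (rdist x y <= L%:E)%E.
Proof.
move=> cx cy H; set u := coord c x in H; set v := coord c y - u in H.
have Hi t : 0 <= t <= 1 -> image_of c (u + t *: v) by move=> /H[].
apply: (@le_trans _ _ (curve_length (gamma u v))).
  apply: ereal_inf_lbound; exists (gamma u v) => //; split; last 2 first.
  - by rewrite /gamma scale0r addr0 coordK.
  - by rewrite /gamma scale1r addrC subrK coordK.
  exists 1%N, (fun i => i%:R); split => //; case=> // _; split; first exact: ltr01.
  have i0 : image_of c (u + (0 : R) *: v) by apply: Hi; rewrite lexx ler01.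
  have i1 : image_of c (u + (1 : R) *: v) by apply: Hi; rewrite lexx ler01.
  (* The segment extends a little beyond both ends inside the open chart image, so that it serves as
     its own C^1 extension. *)
  have /nbhs_normP[e0 /= e00 He0] := near_line i0.
  have /nbhs_normP[e1 /= e10 He1] := near_line i1.
  exists (gamma u v), (Num.min e0 e1); split => //; first by rewrite lt_min e00.
  move=> t /andP[]; rewrite sub0r => t0 t1; apply: gamma_C1.
  have [tp|tn] := leP 0 t; last first.
    apply: He0 => /=; rewrite sub0r normrN ltr0_norm// ltrNl (le_lt_trans _ t0)//.
    by rewrite lerN2 ge_min lexx.
  have [tl|tg] := leP t 1; first by apply: Hi; rewrite tp.
  apply: He1 => /=; rewrite ltr0_norm ?subr_lt0// opprB ltrBlDl.
  by rewrite (lt_le_trans t1)// lerD2l ge_min lexx orbT.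
have sp t : 0 <= t <= 1 -> speed (gamma u v) t = gnorm (gmx c (u + t *: v)) v.
  move=> /Hi cut; have D := gamma_derive cut.
  rewrite (speedE (gamma_continuous cut) (dom_param cut) (@ex_derive _ _ _ _ _ _ _ D)).
  by rewrite derive1E (@derive_val _ _ _ _ _ _ _ D) paramK.
have cs : {within `[0, 1], continuous (speed (gamma u v))}.
  apply: continuous_in_subspaceT => t; rewrite inE/= in_itv/= => /Hi cut.
  apply: speed_continuous; apply: filterS (near_line cut) => s; exact: gamma_C1.
apply: (@le_trans _ _ (\int[lebesgue_measure]_(t in `[0%R, 1%R]) (cst L%:E t))%E).
  apply: ge0_le_integral => //.
  - by move=> t _; rewrite lee_fin sqrtr_ge0.
  - apply/measurable_EFinP; exact: subspace_continuous_measurable_fun cs.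
  - by move=> t /=; rewrite in_itv/= => t01; rewrite lee_fin [leLHS]sp//; case: (H t t01).
rewrite integral_cst//= lebesgue_measure_itv/= lte_fin ltr01 oppr0 adde0.
by rewrite mule1.
Qed.

Lemma rdist_ge0 x y : (0 <= rdist x y)%E.
Proof. by apply: le_ereal_inf_tmp => _ [gamma' _ <-]; exact: curve_length_ge0. Qed.

End StraightLines.

(** * Cutoff functions with controlled slope *)

Section PositivePartSquare.
Variable R : realType.

(** Squaring makes the positive part C^1, which is all the regularity that test functions need. *)
Definition sqpos (x : R) : R := Num.max 0 x ^+ 2.

Lemma sqpos_is_derive (x : R) : is_derive x 1 sqpos (2 * Num.max 0 x).
Proof.
suff L : (fun h : R => h^-1 *: ((sqpos \o shift x) (h *: (1 : R)) - sqpos x)) @ 0^'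
    --> 2 * Num.max 0 x.
  by apply: DeriveDef; [exact: (cvgP _ L)|exact: cvg_lim L].
apply/cvgrPdist_le => e e0; near=> h.
have h0 : h != 0 by near: h; exact: nbhs_dnbhs_neq.
rewrite /= -[h *: 1]/(h * 1) mulr1 -[_ *: _]/(_ * _).
have -> : 2 * Num.max 0 x - h^-1 * (sqpos (h + x) - sqpos x) =
    - (h^-1 * (sqpos (h + x) - sqpos x - 2 * h * Num.max 0 x)) by field.
rewrite normrN normrM normfV ler_pdivrMl ?normr_gt0//.
(* The first order remainder of [sqpos] is at most h^2 in absolute value, whatever the signs of x
   and h + x. *)
apply: (@le_trans _ _ (`|h| * `|h|)); last first.
  by rewrite ler_wpM2l//; near: h; exact: dnbhs0_le.
rewrite -expr2 real_normK ?num_real// ler_norml /sqpos.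
have := sqr_ge0 h; have := sqr_ge0 (h + x); have := sqr_ge0 x.
case: (leP 0 x) => x0; case: (leP 0 (h + x)) => hx0; rewrite ?expr0n/=; nra.
Unshelve. all: by end_near. Qed.

Lemma max0_continuous : continuous (fun x : R => Num.max 0 x).
Proof.
move=> x; apply: (@continuous_max _ _ (fun=> 0) id); [exact: cvg_cst|exact: cvg_id].
Qed.

Lemma derive_comp_real (n : nat) (g : 'rV[R]_n -> R) (psi : R -> R) (a : R) z v :
    differentiable g z -> is_derive (g z) 1 psi a ->
  differentiable (psi \o g) z /\ 'D_v (psi \o g) z = a * 'D_v g z.
Proof.
move=> dg D; have dpsi : differentiable psi (g z).
  by apply/derivable1_diffP; exact: (@ex_derive _ _ _ _ _ _ _ D).
have dc : differentiable (psi \o g) z by exact: differentiable_comp.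
split=> //; rewrite deriveE// diff_comp//= (deriveE v dg).
have E : 'd g z v = 'd g z v *: (1 : R) by rewrite -[RHS]/(_ * 1) mulr1.
rewrite [in LHS]E linearZ -(deriveE (1 : R) dpsi) (@derive_val _ _ _ _ _ _ _ D).
by rewrite mulrC.
Qed.

End PositivePartSquare.

Section QuadraticFunctions.
Variables (R : realType) (n : nat) (G : 'M[R]_n) (u0 e : 'rV[R]_n).
Hypothesis G_sym : G^T = G.

Lemma quadratic_is_derive (g : 'rV[R]_n -> R) z v (a b : R) :
  (forall h, g (h *: v + z) = g z + h * a + h ^+ 2 * b) -> is_derive z v g a.
Proof.
move=> Hg.
suff L : (fun h : R => h^-1 *: ((g \o shift z) (h *: v) - g z)) @ 0^' --> a.
  by apply: DeriveDef; [exact: (cvgP _ L)|exact: cvg_lim L].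
apply: (@cvg_trans _ ((fun h : R => a + h * b) @ 0^')).
  apply: near_eq_cvg; near=> h.
  have h0 : h != 0 by near: h; exact: nbhs_dnbhs_neq.
  by rewrite /= Hg -[_ *: _]/(_ * _); field.
have L : (fun h : R => a + h * b) @ 0^' --> a + 0 * b.
  apply: cvgD; first exact: cvg_cst.
  by apply: cvgMl; apply: (@cvg_within _ (nbhs (0 : R))).
by rewrite mul0r addr0 in L.
Unshelve. all: by end_near. Qed.

Lemma differentiable_bform (a b : 'rV[R]_n -> 'rV[R]_n) z :
  differentiable a z -> differentiable b z ->
  differentiable (fun x => bform G (a x) (b x)) z.
Proof.
move=> da db.
have dc (a' : 'rV[R]_n -> 'rV[R]_n) j : differentiable a' z ->
    differentiable (fun x => a' x 0 j) z.
  move=> da'; apply: (@differentiable_comp _ _ _ _ a' (fun B => B 0 j)) => //.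
  exact: differentiable_coord.
rewrite (_ : (fun x => _) = \sum_i \sum_j
    (((fun x => a x 0 i) * cst (G i j)) * (fun x => b x 0 j))); last first.
  apply/funext => x; rewrite bformE fct_sumE; apply: eq_bigr => i _.
  by rewrite fct_sumE.
apply: differentiable_sum => i; apply: differentiable_sum => j.
apply: differentiableM; last exact: dc.
by apply: differentiableM; [exact: dc|exact: differentiable_cst].
Qed.

Lemma differentiable_centered z : differentiable (fun x => x - u0 : 'rV[R]_n) z.
Proof.
apply: differentiableD; last exact: differentiable_cst.
by apply: (@linear_differentiable _ _ _ idfun) => ? //.
Qed.

Lemma linear_differentiable_derive z v :
  differentiable (fun x => bform G (x - u0) e) z /\
  'D_v (fun x => bform G (x - u0) e) z = bform G v e.
Proof.
split.
  apply: differentiable_bform; first exact: differentiable_centered.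
  exact: differentiable_cst.
apply: derive_val; apply: (@quadratic_is_derive _ _ _ _ 0) => h.
by rewrite -(addrA (h *: v)) bformDl bformZl; ring.
Qed.

Lemma square_differentiable_derive z v :
  differentiable (fun x => bform G (x - u0) (x - u0)) z /\
  'D_v (fun x => bform G (x - u0) (x - u0)) z = 2 * bform G (z - u0) v.
Proof.
split; first by apply: differentiable_bform; exact: differentiable_centered.
apply: derive_val; apply: (@quadratic_is_derive _ _ _ _ (bform G v v)) => h.
rewrite -(addrA (h *: v)); move: (z - u0) => p.
rewrite !bformDl !bformDr !bformZl !bformZr (bformC v _ G_sym).
by ring.
Qed.

End QuadraticFunctions.

Section Cutoff.
Variables (R : realType) (n : nat) (G : 'M[R]_n) (u0 : 'rV[R]_n) (rho : R).
Hypotheses (G_sym : G^T = G) (G_psd : forall z, 0 <= bform G z z) (rho_gt0 : 0 < rho).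
Implicit Types z v e : 'rV[R]_n.

Let q z := bform G (z - u0) (z - u0) / rho ^+ 2.
Let m z := Num.max 0 (1 - q z).

Definition cutoff z : R := sqpos (1 - q z).

Definition cut_linear e z : R := bform G (z - u0) e * cutoff z.

Let q_ge0 z : 0 <= q z.
Proof. by rewrite divr_ge0// sqr_ge0. Qed.

Lemma cutoff_center : cutoff u0 = 1.
Proof.
by rewrite /cutoff /q subrr bform0l mul0r subr0 /sqpos max_r ?ler01// expr1n.
Qed.

Lemma cutoff_far z : rho <= gnorm G (z - u0) -> cutoff z = 0.
Proof.
move=> Hz; rewrite /cutoff /sqpos max_l ?expr0n// subr_le0.
rewrite ler_pdivlMr ?exprn_gt0// mul1r -sqr_gnorm//.
by rewrite ler_pXn2r ?nnegrE// ?gnorm_ge0 ?ltW.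
Qed.

Lemma cutoff_derive z v : differentiable cutoff z /\
  'D_v cutoff z = - (4 / rho ^+ 2) * m z * bform G (z - u0) v.
Proof.
have [ds Ds] := square_differentiable_derive u0 G_sym z v.
have dq : differentiable (fun x => 1 - q x) z.
  apply: differentiableB; first exact: differentiable_cst.
  by apply: differentiableM => //; exact: differentiable_cst.
have Dq : 'D_v (fun x => 1 - q x) z = - (2 / rho ^+ 2) * bform G (z - u0) v.
  rewrite deriveB//; last first.
    by apply/diff_derivable/differentiableM => //; exact: differentiable_cst.
  rewrite derive_cst sub0r /q deriveMr; last exact: diff_derivable.
  by rewrite Ds; ring.
have [dc Dc] := derive_comp_real v dq (sqpos_is_derive (1 - q z)).
by split=> //; rewrite /cutoff [LHS]Dc Dq -/(m z); ring.
Qed.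

Lemma cut_linear_derive e z v : differentiable (cut_linear e) z /\
  'D_v (cut_linear e) z = m z ^+ 2 * bform G v e
    - (4 / rho ^+ 2) * m z * bform G (z - u0) v * bform G (z - u0) e.
Proof.
have [dl Dl] := linear_differentiable_derive G u0 e z v.
have [dc Dc] := cutoff_derive z v.
split; first exact: differentiableM.
rewrite /cut_linear deriveM; [|exact: diff_derivable|exact: diff_derivable].
by rewrite Dl Dc -![_ *: _]/(_ * _) {1}/cutoff /sqpos -/(m z); ring.
Qed.

Let m_continuous : continuous m.
Proof.
move=> z; apply: (@continuous_comp _ _ _ (fun x => 1 - q x)
  (fun x : R => Num.max 0 x)); last exact: max0_continuous.
apply: differentiable_continuous; apply: differentiableB; first exact: differentiable_cst.
apply: differentiableM; last exact: differentiable_cst.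
by have [] := square_differentiable_derive u0 G_sym z 0.
Qed.

Let linear_continuous e : continuous (fun z => bform G (z - u0) e).
Proof.
move=> z; apply: differentiable_continuous.
by have [] := linear_differentiable_derive G u0 e z 0.
Qed.

Let contM (f g : 'rV[R]_n -> R) : continuous f -> continuous g ->
  continuous (fun z => f z * g z).
Proof. by move=> cf cg z; apply: (@cvgM _ _ (nbhs z)); [exact: cf|exact: cg]. Qed.

Lemma cutoff_derive_continuous v : continuous ('D_v cutoff).
Proof.
rewrite (_ : 'D_v cutoff = fun z => - (4 / rho ^+ 2) * m z * bform G (z - u0) v); last first.
  by apply/funext => z; have [] := cutoff_derive z v.
apply: contM; last exact: linear_continuous.
by apply: contM; [exact: cst_continuous|exact: m_continuous].
Qed.

Lemma cut_linear_derive_continuous e v : continuous ('D_v (cut_linear e)).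
Proof.
rewrite (_ : 'D_v _ = fun z => m z ^+ 2 * bform G v e
    - (4 / rho ^+ 2) * m z * bform G (z - u0) v * bform G (z - u0) e); last first.
  by apply/funext => z; have [] := cut_linear_derive e z v.
move=> z; apply: (@cvgB _ _ _ (nbhs z)); move: z.
  apply: contM; last exact: cst_continuous.
  exact: contM m_continuous m_continuous.
apply: contM; last exact: linear_continuous.
apply: contM; last exact: linear_continuous.
by apply: contM; [exact: cst_continuous|exact: m_continuous].
Qed.

Lemma cutoff_derive_far z v : rho <= gnorm G (z - u0) -> 'D_v cutoff z = 0.
Proof.
move=> Hz; have [_ ->] := cutoff_derive z v.
have : m z ^+ 2 = 0 by have := cutoff_far Hz.
by move/eqP; rewrite sqrf_eq0 => /eqP ->; rewrite mulr0 mul0r.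
Qed.

Lemma cut_linear_derive_far e z v : rho <= gnorm G (z - u0) ->
  'D_v (cut_linear e) z = 0.
Proof.
move=> Hz; have [_ ->] := cut_linear_derive e z v.
have : m z ^+ 2 = 0 by have := cutoff_far Hz.
by move/eqP; rewrite sqrf_eq0 => /eqP ->; rewrite expr0n/= mulr0 !mul0r subr0.
Qed.

Let m_cases z : m z = 0 \/ (0 <= q z <= 1 /\ m z = 1 - q z).
Proof.
rewrite /m; have [q1|q1] := leP 0 (1 - q z); [right|by left].
by split=> //; rewrite q_ge0 -subr_ge0.
Qed.

Let bform_center z v : (bform G (z - u0) v / rho) ^+ 2 <= q z * gnorm G v ^+ 2.
Proof.
rewrite sqr_gnorm// /q expr_div_n [leRHS]mulrAC ler_wpM2r ?invr_ge0 ?sqr_ge0//.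
exact: bform_CS.
Qed.

(** By Cauchy-Schwarz b^2 <= q |v|^2, and m and q are at most 1 where m does not vanish. The
    constant 4 is crude but harmless: it only enters the smallness condition of [rdist_lower]. *)
Lemma cutoff_derive_le z v : `|'D_v cutoff z| <= 4 / rho * gnorm G v.
Proof.
have [_ ->] := cutoff_derive z v.
set b := bform G (z - u0) v / rho.
have -> : - (4 / rho ^+ 2) * m z * bform G (z - u0) v = - (4 / rho * (m z * b)).
  by rewrite /b; field; rewrite gt_eqF.
have r0 : 0 <= 4 / rho by rewrite divr_ge0// ltW.
rewrite normrN normrM ger0_norm// ler_wpM2l//.
rewrite -(ler_pXn2r (ltn0Sn 1)) ?nnegrE ?gnorm_ge0//.
rewrite -normrX ger0_norm ?sqr_ge0// exprMn.
have := bform_center z v; rewrite -/b; have := sqr_ge0 (gnorm G v); have := sqr_ge0 b.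
case: (m_cases z) => [->|[/andP[q0 q1] ->]]; first by rewrite expr0n/= mul0r.
move: (gnorm G v ^+ 2) (b ^+ 2) => V B B0 V0 BV.
have : (1 - q z) ^+ 2 <= 1 by nra.
nra.
Qed.

(* With [p = (z - u0) / rho] and [q = |p|^2 < 1], the gradient of the cut linear
   form is [T e], where [T = (1 - q) ((1 - q) I - 4 p p^T)] has its eigenvalues
   [(1 - q)^2] and [(1 - q) (1 - 5 q)] in [-1, 1]. *)
Lemma cut_linear_derive_le e z v :
  `|'D_v (cut_linear e) z| <= gnorm G v * gnorm G e.
Proof.
have [_ ->] := cut_linear_derive e z v.
(* [w] is T v. As T is self-adjoint for G, the derivative is the inner product of T v and e, and it
   remains to show |T v| <= |v|. *)
pose w := (m z ^+ 2) *: v - (4 / rho ^+ 2 * m z * bform G (z - u0) v) *: (z - u0).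
have -> : m z ^+ 2 * bform G v e
    - 4 / rho ^+ 2 * m z * bform G (z - u0) v * bform G (z - u0) e = bform G w e.
  by rewrite /w [RHS]bformBl !bformZl.
rewrite (le_trans (bform_le_gnorm _ _ G_sym G_psd))// ler_wpM2r ?gnorm_ge0//.
rewrite -(ler_pXn2r (ltn0Sn 1)) ?nnegrE ?gnorm_ge0// [leLHS]sqr_gnorm//.
set b := bform G (z - u0) v / rho.
have -> : bform G w w = m z ^+ 4 * gnorm G v ^+ 2 - 8 * m z ^+ 3 * b ^+ 2 +
    16 * m z ^+ 2 * b ^+ 2 * q z.
  rewrite sqr_gnorm// /w /b /q; move: (m z) (z - u0) => mz p.
  rewrite !bformBl !bformBr !bformZl !bformZr.
  by rewrite (bformC v p G_sym); field; rewrite gt_eqF.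
have := bform_center z v; rewrite -/b; have := sqr_ge0 (gnorm G v); have := sqr_ge0 b.
case: (m_cases z) => [->|[/andP[q0 q1] ->]].
  by rewrite !expr0n/= !(mul0r, mulr0) subr0 addr0.
move: (gnorm G v ^+ 2) (b ^+ 2) (q z) q0 q1 => V B t t0 t1 B0 V0 BV.
have -> : (1 - t) ^+ 4 * V - 8 * (1 - t) ^+ 3 * B + 16 * (1 - t) ^+ 2 * B * t =
  (1 - t) ^+ 2 * ((1 - t) ^+ 2 * V + 8 * (3 * t - 1) * B) by ring.
have t2 : 0 <= (1 - t) ^+ 2 <= 1 by rewrite sqr_ge0/=; nra.
move/andP: t2 => [t20 t21].
(* The coefficient of B changes sign at t = 1/3. Below, the B term is dropped and the eigenvalue (1
   - t)^2 remains; above, B is replaced by its bound t V, which produces the square of the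
   eigenvalue (1 - t) (1 - 5 t). *)
have [t3|t3] := leP (3 * t) 1.
  apply: (@le_trans _ _ ((1 - t) ^+ 2 * ((1 - t) ^+ 2 * V))).
    by rewrite ler_wpM2l//; nra.
  apply: (@le_trans _ _ ((1 - t) ^+ 2 * V)); first by rewrite ler_wpM2l//; nra.
  nra.
apply: (@le_trans _ _ ((1 - t) ^+ 2 * ((1 - t) ^+ 2 * V + 8 * (3 * t - 1) * (t * V)))).
  by rewrite ler_wpM2l// lerD2l ler_wpM2l//; lra.
have -> : (1 - t) ^+ 2 * ((1 - t) ^+ 2 * V + 8 * (3 * t - 1) * (t * V)) =
  ((1 - t) * (1 - 5 * t)) ^+ 2 * V by ring.
have : -1 <= (1 - t) * (1 - 5 * t) <= 1 by apply/andP; split; nra.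
move=> /andP[]; move: ((1 - t) * (1 - 5 * t)) => s s1 s2.
have : s ^+ 2 <= 1 by nra.
nra.
Qed.

(** Since m lies in [0, 1], k <= m^2 <= m, and m = 1 - q wherever it is positive. *)
Lemma cutoff_lower z (k : R) : 0 < k -> k <= cutoff z -> 
  gnorm G (z - u0) ^+ 2 <= (1 - k) * rho ^+ 2.
Proof.
rewrite /cutoff /sqpos -/(m z) => k0 km.
rewrite sqr_gnorm// -ler_pdivrMr ?exprn_gt0// -/(q z); move: km.
by case: (m_cases z) => [->|[/andP[q0 q1] ->]]; rewrite ?expr0n/=; nra.
Qed.

End Cutoff.

(** * Lower bound for the distance by the norm in a chart *)

Section DistanceLowerBound.
Variables (R : realType) (n : nat) (M : riemannianManifold R n) (c : chart M).
Variables (G : 'M[R]_n) (m r a : R) (x : M).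
Hypotheses (G_sym : G^T = G) (G_pos : posdef G).
Hypotheses (m_gt0 : 0 < m) (G_lower : forall v, m * `|v| <= gnorm G v).
Hypotheses (r_gt0 : 0 < r) (a_gt0 : 0 < a) (cx : dom c x).
Hypothesis ball_bound : forall z, `|z - coord c x| <= r ->
  image_of c z /\ forall v, gnorm G v <= a * gnorm (gmx c z) v.

Let u0 := coord c x.
Let rho := m * r.
Let K := [set z : 'rV[R]_n | `|z - u0| <= r].
Let G_psd := posdef_psd G_pos.

Let rho_gt0 : 0 < rho. Proof. exact: mulr_gt0. Qed.

Let K_compact : compact K.
Proof.
apply: bounded_closed_compact.
  exists (r + `|u0|); split; first exact: num_real.
  move=> b rb z /= zK; rewrite -(subrK u0 z) (le_trans (ler_normD _ _))//.
  by rewrite (le_trans _ (ltW rb))// lerD2r.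
rewrite (_ : K = closed_ball_ Num.norm u0 r); first exact: closed_closed_ball_.
by apply/seteqP; split=> z /=; rewrite /K/= distrC.
Qed.

Let K_sub : K `<=` image_of c.
Proof. by move=> z /ball_bound[]. Qed.

Let outside z : ~ K z -> rho <= gnorm G (z - u0).
Proof.
move=> /negP; rewrite -ltNge => /ltW rz; rewrite (le_trans _ (G_lower _))//.
by rewrite ler_wpM2l// ltW.
Qed.

Let slope (Phi : 'rV[R]_n -> R) (C : R) : 0 <= C ->
    (forall z v, 'D_v Phi z <= C * gnorm G v) ->
    (forall z v, rho <= gnorm G (z - u0) -> 'D_v Phi z = 0) ->
  forall z v, image_of c z -> 'D_v Phi z <= (C * a) * gnorm (gmx c z) v.
Proof.
move=> C0 HC H0 z v _; have [Kz|Kz] := pselect (K z); last first.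
  by rewrite H0; [rewrite !mulr_ge0 ?gnorm_ge0// ltW|exact: outside].
rewrite (le_trans (HC z v))// -mulrA ler_wpM2l//.
by have [_] := ball_bound Kz; apply.
Qed.

(** The bump equals 1 at x and has slope at most 4 a / rho with rho = m r, so the smallness
    condition leaves at least 1 - k of it at y. With e the coordinate difference, the cut linear
    form then grows by at least (1 - k) |e|^2 from x to y while its slope is at most a |e|; dividing
    by |e| gives the last claim. *)
Lemma rdist_lower y (d k : R) : 0 < k < 1 -> 4 * a * d <= k * (m * r) ->
    (rdist x y <= d%:E)%E ->
  [/\ dom c y, `|coord c y - coord c x| <= r &
      (1 - k) * gnorm G (coord c y - coord c x) <= a * d].
Proof.
move=> /andP[k0 k1] dk xyd.
have scale_rdist (C : R) : 0 < C -> (C%:E * rdist x y <= (C * d)%:E)%E.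
  by move=> C0; rewrite [leRHS]EFinM lee_pmul2l.
have Ec : extend0 c (cutoff G u0 rho) x = 1.
  by rewrite extend0_dom// cutoff_center.
have near_y : 1 - k <= extend0 c (cutoff G u0 rho) y.
  (* [extend0_rdist] bounds the increase from x to y, whereas the decrease of the bump has to be
     controlled; hence the sign. *)
  pose Psi z : R := - cutoff G u0 rho z.
  have dPsi z v : differentiable Psi z /\ 'D_v Psi z = - 'D_v (cutoff G u0 rho) z.
    have [dc _] := cutoff_derive u0 rho G_sym z v.
    by split; [exact: differentiableN|rewrite deriveN//; exact: diff_derivable].
  have C0 : 0 < 4 / rho by rewrite divr_gt0.
  have := @extend0_rdist R n M c K Psi (4 / rho * a) K_compact K_sub.
  have E z : extend0 c Psi z = - extend0 c (cutoff G u0 rho) z.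
    by rewrite /extend0; case: ifP; rewrite ?oppr0.
  move=> /(_ _ _ _ _ _ x y); rewrite !E Ec opprK => H.
  have : ((- extend0 c (cutoff G u0 rho) y + 1)%:E <= (4 / rho * a)%:E * rdist x y)%E.
    apply: H.
    - by move=> z /outside Kz; rewrite /Psi cutoff_far// oppr0.
    - by move=> z _; have [] := dPsi z 0.
    - move=> v z _; rewrite (_ : 'D_v Psi = fun z => - 'D_v (cutoff G u0 rho) z).
        apply: (@cvgN _ _ _ (nbhs z)). exact: (cutoff_derive_continuous G_sym).
      by apply/funext => w; have [] := dPsi w v.
    - by rewrite mulr_gt0.
    - apply: slope => [||z v Hz]; first exact: ltW.
        move=> z v; have [_ ->] := dPsi z v.
        by rewrite (le_trans (ler_norm _))// normrN cutoff_derive_le.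
      by have [_ ->] := dPsi z v; rewrite cutoff_derive_far// oppr0.
  move=> /le_trans/(_ (scale_rdist _ (mulr_gt0 C0 a_gt0))); rewrite lee_fin.
  have : 4 / rho * a * d <= k.
    have -> : 4 / rho * a * d = 4 * a * d / rho by ring.
    by rewrite ler_pdivrMr.
  lra.
have cy : dom c y.
  apply: contrapT => cy; move: near_y; rewrite /extend0 asboolF//; lra.
move: near_y; rewrite extend0_dom//; set w := coord c y => Hw.
have wr : `|w - u0| <= r.
  have K1 : 0 < 1 - k by lra.
  have := cutoff_lower G_psd rho_gt0 K1 Hw.
  rewrite subKr => H1.
  have H2 : gnorm G (w - u0) <= rho.
    rewrite -(ler_pXn2r (ltn0Sn 1)) ?nnegrE ?gnorm_ge0// ?(ltW rho_gt0)//.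
    by rewrite (le_trans H1)// ler_piMl ?sqr_ge0// ltW.
  by rewrite -(ler_pM2l m_gt0) (le_trans (G_lower _)).
split => //.
(* This case is separate because the slope constant given to [extend0_rdist] must be positive. *)
have [w0|w0] := eqVneq w u0.
  rewrite -/u0 w0 subrr /gnorm bform0l sqrtr0 mulr0 mulr_ge0// ?(ltW a_gt0)//.
  by rewrite -lee_fin (le_trans _ xyd)// rdist_ge0.
have e0 : 0 < gnorm G (w - u0).
  rewrite (lt_le_trans _ (G_lower _))// mulr_gt0// normr_gt0 subr_eq0//.
pose Phi := cut_linear G u0 rho (w - u0).
have dPhi z v := cut_linear_derive u0 rho G_sym (w - u0) z v.
have : ((extend0 c Phi y - extend0 c Phi x)%:E <= (gnorm G (w - u0) * a)%:E * rdist x y)%E.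
  apply: (@extend0_rdist R n M c K).
  - exact: K_compact.
  - exact: K_sub.
  - by move=> z /outside Kz; rewrite /Phi /cut_linear cutoff_far// mulr0.
  - by move=> z _; have [] := dPhi z 0.
  - by move=> v z _; exact: cut_linear_derive_continuous.
  - by rewrite mulr_gt0.
  - apply: slope => [|z v|z v Hz]; first exact: ltW.
      by rewrite (le_trans (ler_norm _))// mulrC cut_linear_derive_le.
    exact: cut_linear_derive_far.
move=> /le_trans/(_ (scale_rdist _ (mulr_gt0 e0 a_gt0))).
rewrite lee_fin !extend0_dom// /Phi /cut_linear -/u0 -/w subrr bform0l mul0r subr0.
rewrite -sqr_gnorm// expr2 -!mulrA ler_pM2l//; apply: le_trans.
by rewrite mulrC ler_pM2l.
Qed.

End DistanceLowerBound.

Lemma near_bform_close (R : realType) (n : nat) (G : 'M[R]_n)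
    (H : 'rV[R]_n -> 'M[R]_n) u (tau : R) :
    posdef G -> {for u, continuous H} -> 0 < tau ->
  \forall z \near u, forall v w,
    `|bform (H z) v w - bform (H u) v w| <= tau * (gnorm G v * gnorm G w).
Proof.
move=> pG cH tau0; have [m m0 Hm] := posdef_lower_bound pG.
pose N : R := (n * n)%:R.
have N0 : 0 <= N by rewrite ler0n.
have N1 : 0 < N + 1 by rewrite ltr_wpDl.
(* Summing the n^2 entries costs a factor N, and each of the two passages from the sup norm to the
   norm of G costs 1 / m; the denominator N + 1 is positive even in dimension 0. *)
have e0 : 0 < tau * m ^+ 2 / (N + 1) by rewrite divr_gt0// mulr_gt0// exprn_gt0.
have /cvgrPdist_le/(_ _ e0) := cH; apply: filterS => z zH v w.
rewrite -bform_mxB (le_trans (bform_le_norm _ _ _))// -/N distrC.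
have nv := Hm v; have nw := Hm w.
apply: (@le_trans _ _ (tau * ((m * `|v|) * (m * `|w|)))); last first.
  by rewrite ler_pM2l// ler_pM// mulr_ge0// ltW.
have -> : tau * ((m * `|v|) * (m * `|w|)) = (tau * m ^+ 2) * `|v| * `|w| by ring.
rewrite ler_wpM2r// ler_wpM2r//.
rewrite (@le_trans _ _ (N * (tau * m ^+ 2 / (N + 1))))//.
  by rewrite ler_wpM2l// distrC.
rewrite mulrCA ler_piMr//; first by rewrite mulr_ge0 ?sqr_ge0// ltW.
by rewrite ler_pdivrMr// mul1r lerDl.
Qed.

(** * Estimates at a critical point *)

Lemma local_min_coord (R : realType) (n : nat) (M : riemannianManifold R n)
    (c : chart M) (f : M -> R) (y : M) : dom c y -> is_local_min f y ->
  \forall w \near coord c y,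
    (f \o param c) (coord c y) <= (f \o param c) w.
Proof.
move=> cy ymin; have iw := image_of_coord cy.
have := @param_continuous R n M c _ iw [set z | f y <= f z].
by rewrite /= coordK//; apply.
Qed.

Section LocalEstimates.
Variables (R : realType) (n : nat) (M : riemannianManifold R n) (c : chart M).
Variables (f : M -> R) (f_C2 : classC 2 f) (G H : 'M[R]_n) (u0 : 'rV[R]_n).
Variables (m r a e L : R).
Let F := f \o param c.
Hypotheses (G_sym : G^T = G) (G_pos : posdef G).
Hypotheses (m_gt0 : 0 < m) (G_lower : forall v, m * `|v| <= gnorm G v).
Hypotheses (r_gt0 : 0 < r) (a_gt1 : 1 < a) (e_ge0 : 0 <= e) (L_ge0 : 0 <= L).
Hypothesis H_le : forall v w, `|bform H v w| <= L * (gnorm G v * gnorm G w).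
Hypothesis ball_bound : forall z, `|z - u0| <= 2 * r ->
  [/\ image_of c z,
      forall v, gnorm G v <= a * gnorm (gmx c z) v,
      forall v, gnorm (gmx c z) v <= a * gnorm G v &
      forall v w, `|bform (hessian F z) v w - bform H v w| <=
                  e * (gnorm G v * gnorm G w)].

(** Two of the three factors a come from |v| <= a^2 D, the third from passing between G and the
    metric at x. The radius 2 r is needed because y is only known to be within r of x. *)
Lemma critical_point_estimates (x y : M) (D : R) :
    dom c x -> `|coord c x - u0| <= r -> is_local_min f y ->
    4 * a * D <= (1 - a^-1) * (m * r) -> (rdist x y <= D%:E)%E ->
  let N := tangent_norm x (grad f x) in
  N <= (L + e) * a ^+ 3 * D /\
  2 * (f x - f y) <= N * a ^+ 3 * D + 2 * e * (a ^+ 2 * D) ^+ 2.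
Proof.
move=> cx xr ymin Dr xyD N; pose u := coord c x.
have a0 : 0 < a by rewrite (lt_trans ltr01).
have ball z : `|z - u| <= r -> `|z - u0| <= 2 * r.
  move=> zu; rewrite -(subrK u z) -addrA (le_trans (ler_normD _ _))//.
  by rewrite mulr2n mulrDl !mul1r lerD.
(* With k = 1 - 1/a, dividing by 1 - k in [rdist_lower] costs exactly one more factor a. *)
have k01 : 0 < 1 - a^-1 < 1.
  by rewrite subr_gt0 invf_lt1// a_gt1 gtrBl invr_gt0.
have ball' z : `|z - coord c x| <= r ->
  image_of c z /\ forall v, gnorm G v <= a * gnorm (gmx c z) v.
  by move=> /ball/ball_bound[].
have [cy yr vD] := rdist_lower G_sym G_pos m_gt0 G_lower r_gt0 a0 cx ball' k01 Dr xyD.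
pose w := coord c y; rewrite -/w -/u subKr in yr vD.
pose v := u - w.
have {}vD : gnorm G v <= a ^+ 2 * D.
  have -> : gnorm G v = gnorm G (w - u).
    by rewrite -[v]opprB -scaleN1r gnormZ normrN1 mul1r.
  by rewrite expr2 -mulrA -ler_pdivrMl.
have D0 : 0 <= D by rewrite -lee_fin (le_trans _ xyD)// rdist_ge0.
have G_psd := posdef_psd G_pos.
have uE : w + v = u by rewrite /v addrC subrK.
have seg t : 0 <= t <= 1 -> `|w + t *: v - u0| <= 2 * r.
  move=> /andP[t0 t1]; apply: ball.
  have -> : w + t *: v - u = (1 - t) *: (w - u).
    by rewrite /v -(opprB w u) scalerN scalerBl scale1r addrAC.
  by rewrite normrZ ger0_norm ?subr_ge0// (le_trans _ yr)// ler_piMl// gerBl.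
have segi t : 0 <= t <= 1 -> image_of c (w + t *: v) by move=> /seg/ball_bound[].
have u_ball : `|u - u0| <= 2 * r by apply: ball; rewrite subrr normr0 ltW.
have [iu ub1 ub2 _] := ball_bound u_ball.
have iw := image_of_coord cy.
have wmin := local_min_coord cy ymin.
have iop : open (image_of c) by exact: image_of_open.
have crit z : 'D_z F w = 0.
  exact: (local_min_derive iop (f_C2 c) iw wmin z).
have G_psd_u := posdef_psd (posdef_gmx iu).
have NE : N = gnorm (gmx c u) (grad_in c f u) by exact: tangent_norm_gradE.
have N0 : 0 <= N by rewrite NE gnorm_ge0.
have gradle z : 'D_z F u <= N * gnorm (gmx c u) z.
  rewrite -(grad_inP f_C2)// NE (le_trans (ler_norm _))//.
  by apply: bform_le_gnorm => //; exact: gmx_sym.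
split.
  (* A scalar mean value theorem suffices: the derivative of F in the fixed direction g vanishes at
     w and equals N^2 at u, so N^2 is a value of the Hessian form at (v, g), and one factor N is
     then cancelled. *)
  pose g := grad_in c f u.
  have [|d d01] := @MVT_line R n ('D_g F) w v 1 ltr01.
    move=> t t01; apply: (C2_differentiable_derive (f_C2 c)); exact: segi.
  rewrite crit scale1r mul1r subr0 uE -(grad_inP f_C2)// -/g.
  rewrite -sqr_gnorm// -NE (hessianE iop (f_C2 c))//; last exact: segi.
  move=> NN; have [_ _ _ Hc] := ball_bound (seg d d01).
  have Le : 0 <= L + e by exact: addr_ge0.
  have N2 : N ^+ 2 <= (L + e) * (gnorm G v * gnorm G g).
    have := Hc v g; have := H_le v g.
    rewrite NN ler_distl ler_norml => /andP[_ h1] /andP[_ h2].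
    by rewrite (le_trans h2)// mulrDl lerD2r.
  have [N0'|N0'] := leP N 0.
    by rewrite (le_trans N0')// !mulr_ge0 ?exprn_ge0 ?(ltW a0)//.
  rewrite -(ler_pM2r N0') -expr2 (le_trans N2)//.
  have -> : (L + e) * a ^+ 3 * D * N = (L + e) * ((a ^+ 2 * D) * (a * N)) by ring.
  rewrite ler_wpM2l// ler_pM ?gnorm_ge0// NE; exact: ub1.
have T : 2 * (F (w + v) - F w) <=
    'D_v F (w + v) + 2 * (e * (gnorm G v * gnorm G v)).
  apply: (taylor_critical (f_C2 c) segi (crit v) (q := bform H v v)).
  move=> t t01; rewrite (hessianE iop (f_C2 c)); last exact: segi.
  by have [_ _ _] := ball_bound (seg t t01); apply.
have Fx : F u = f x by rewrite /F/= /u coordK.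
have Fy : F w = f y by rewrite /F/= /w coordK.
move: T; rewrite uE Fx Fy => T; apply: (le_trans T); apply: lerD.
  have -> : N * a ^+ 3 * D = N * (a * (a ^+ 2 * D)) by ring.
  rewrite (le_trans (gradle v))// ler_wpM2l//.
  by rewrite (le_trans (ub2 v))// ler_pM2l.
rewrite mulrA ler_wpM2l ?mulr_ge0// -expr2.
by rewrite ler_pXn2r ?nnegrE ?gnorm_ge0// mulr_ge0 ?exprn_ge0 ?(ltW a0)//.
Qed.

End LocalEstimates.

(** * The Riemannian Hessian at a critical point *)

Section MatrixContinuity.
Variables (R : realType) (T : Type) (S : set_system T).
Context {FS : Filter S}.

Lemma cvg_mulmx (m k l : nat) (A : T -> 'M[R]_(m, k)) (B : T -> 'M[R]_(k, l))
    (A0 : 'M[R]_(m, k)) (B0 : 'M[R]_(k, l)) :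
  A @ S --> A0 -> B @ S --> B0 -> (fun t => A t *m B t) @ S --> A0 *m B0.
Proof.
move=> AA BB; apply: cvg_mx_coord => i j; rewrite mxE.
rewrite (_ : (fun t => _) = fun t => \sum_p A t i p * B t p j).
  apply: cvg_big => [|p _]; first exact: add_continuous.
  by apply: cvgM; exact: cvg_coord.
by apply/funext => t; rewrite mxE.
Qed.

Lemma cvg_det (k : nat) (A : T -> 'M[R]_k) (A0 : 'M[R]_k) :
  A @ S --> A0 -> (fun t => \det (A t)) @ S --> \det A0.
Proof.
move=> AA; apply: cvg_big => [|s _]; first exact: add_continuous.
apply: cvgM; first exact: cvg_cst.
apply: cvg_big => [|i _]; first exact: mul_continuous.
exact: cvg_coord.
Qed.

(** By the adjugate formula. Invertibility is asked along the filter because [invmx] returns its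
    argument unchanged on singular matrices. *)
Lemma cvg_invmx (k : nat) (A : T -> 'M[R]_k) (A0 : 'M[R]_k) : A0 \in unitmx ->
  A @ S --> A0 -> (\forall t \near S, A t \in unitmx) ->
  (fun t => invmx (A t)) @ S --> invmx A0.
Proof.
move=> uA0 AA uA; rewrite [in X in _ --> X]/invmx uA0.
apply: (@cvg_trans _ ((fun t => (\det (A t))^-1 *: \adj (A t)) @ S)).
  by apply: near_eq_cvg; apply: filterS uA => t ut; rewrite /invmx ut.
apply: cvgZ.
  apply: cvgV; last exact: cvg_det.
  by rewrite unitmxE unitfE in uA0.
apply: cvg_mx_coord => i j; rewrite mxE.
rewrite (_ : (fun t => _) = fun t => cofactor (A t) j i); last first.
  by apply/funext => t; rewrite mxE.
apply: cvgM; first exact: cvg_cst.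
apply: cvg_det; apply: cvg_mx_coord => p q; rewrite !mxE.
rewrite (_ : (fun t => _) = fun t => A t (lift j p) (lift i q)); last first.
  by apply/funext => t; rewrite !mxE.
exact: cvg_coord.
Qed.

End MatrixContinuity.

(* The gradient vanishes at a critical point, so the Christoffel symbols do not
   contribute to the Hessian there. *)
Lemma hess_critical (R : realType) (n : nat) (M : riemannianManifold R n)
    (f : M -> R) (x : M) : classC 2 f ->
    (forall z, 'D_z (f \o param (chart_at x)) (coord (chart_at x) x) = 0) ->
  hess f x = hessian (f \o param (chart_at x)) (coord (chart_at x) x) *m
    invmx (gmx (chart_at x) (coord (chart_at x) x)).
Proof.
move=> f_C2; set c := chart_at x; set u := coord c x => crit.
pose F := f \o param c.
have iu : image_of c u by apply: image_of_coord; exact: chart_atP.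
pose P w : 'rV[R]_n := \row_i partial i F w.
have P0 : P u = 0 by apply/rowP => i; rewrite !mxE; exact: crit.
have X0 : grad_in c f u = 0 by rewrite /grad_in -/F -/(P u) P0 mul0mx.
have DX v : 'D_v (grad_in c f) u = v *m hessian F u *m invmx (gmx c u).
  apply: cvg_lim => //.
  (* As P vanishes at u, the difference quotient of the product is that of P times the inverse
     metric at the moving point; continuity of the inverse metric then replaces the product rule. *)
  rewrite (_ : (fun h : R => _) = fun h => (h^-1 *: (P (h *: v + u) - P u)) *m
      invmx (gmx c (h *: v + u))); last first.
    apply/funext => h; rewrite /= X0 P0 !subr0 /grad_in -/F -/(P _).
    by rewrite scalemxAl.
  have L : (fun h : R => h *: v + u) @ 0^' --> u.
    have L0 : (fun h : R => u + h *: v) @ (0 : R) --> u + (0 : R) *: v.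
      exact: line_continuous.
    rewrite scale0r addr0 in L0.
    rewrite (_ : (fun h : R => _) = fun h : R => u + h *: v).
      exact: cvg_within_filter.
    by apply/funext => h; rewrite addrC.
  apply: cvg_mulmx.
    have dP i j : derivable (fun w => P w i j) u v.
      rewrite (_ : (fun w => _) = 'D_(delta_mx 0 j) F); last first.
        by apply/funext => w; rewrite mxE.
      exact/diff_derivable/(C2_differentiable_derive (f_C2 c)).
    have dP' : derivable P u v by apply/derivable_mxP.
    have -> : v *m hessian F u = 'D_v P u.
      rewrite derive_mx//; apply/rowP => j; rewrite !mxE.
      rewrite (_ : (fun w => _) = 'D_(delta_mx 0 j) F); last first.
        by apply/funext => w; rewrite mxE.
      rewrite (derive_coord v (C2_differentiable_derive (f_C2 c) _ iu)).
      by apply: eq_bigr => i _; rewrite mxE.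
    exact: dP'.
  apply: cvg_invmx.
  - by apply: posdef_unitmx; exact: posdef_gmx.
  - exact: (cvg_comp _ _ L (gmx_continuous iu)).
  - have HL : \forall h \near (0 : R)^', image_of c (h *: v + u).
      exact: (L (image_of c) (near_image_of iu)).
    near=> h; apply: posdef_unitmx; apply: posdef_gmx; near: h; exact: HL.
apply/matrixP => i j; rewrite /hess -/c -/u mxE /covd_in X0 DX mxE.
rewrite [X in _ + X]mxE [X in _ + X]big1 ?addr0; last first.
  move=> k _; rewrite big1// => l _; by rewrite [X in _ * X * _]mxE mulr0 mul0r.
by rewrite -mulmxA -rowE mxE.
Unshelve. all: by end_near. Qed.

(** A crude comparison is enough: near the centre the squared norm is at most twice that of G, so a
    segment of G-norm at most e / 2 has length at most e. *)
Lemma rdist_near (R : realType) (n : nat) (M : riemannianManifold R n) (x0 : M)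
    (e : R) : 0 < e -> \forall x \near x0, (rdist x x0 <= e%:E)%E.
Proof.
move=> e0; pose c := chart_at x0; pose u0 := coord c x0; pose G := gmx c u0.
have cx0 : dom c x0 by exact: chart_atP.
have iu0 : image_of c u0 by exact: image_of_coord.
have pG : posdef G by exact: posdef_gmx.
have [r0 r00 r0P] : exists2 r0, 0 < r0 & forall z, `|z - u0| < r0 -> image_of c z /\
    forall v w, `|bform (gmx c z) v w - bform G v w| <= 1 * (gnorm G v * gnorm G w).
  have : \forall z \near u0, image_of c z /\
    forall v w, `|bform (gmx c z) v w - bform G v w| <= 1 * (gnorm G v * gnorm G w).
    apply: filterI; first exact: near_image_of.
    exact: near_bform_close pG (gmx_continuous iu0) ltr01.
  move=> /nbhs_normP[r0 /= r00 r0P]; exists r0 => // z zr.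
  by apply: r0P; rewrite /= distrC.
have cc : {for x0, continuous (coord c)} by exact: coord_continuous.
have cn : {for x0, continuous (fun x => gnorm G (coord c x - u0))}.
  have cs : (fun x => coord c x - u0) @ x0 --> coord c x0 - u0.
    by apply: cvgB; [exact: cc|exact: (@cvg_cst 'rV[R]_n)].
  have := @cvg_comp _ _ _ (fun x => coord c x - u0) (gnorm G) _ _ _ cs
    (@continuous_gnorm R n G _).
  exact.
near=> x.
have cx : dom c x by near: x; exact: near_dom.
have xr : `|coord c x - u0| < r0.
  by near: x; move/cvgr_distC_lt : cc; apply.
have xn : gnorm G (coord c x - u0) <= e / 2.
  near: x; move/cvgr_le : cn; apply.
  by rewrite subrr /gnorm bform0l sqrtr0 divr_gt0.
apply: (rdist_line cx cx0) => t /andP[t0 t1] z.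
have [] : image_of c z /\
    forall v w, `|bform (gmx c z) v w - bform G v w| <= 1 * (gnorm G v * gnorm G w).
  apply: r0P.
  have -> : z - u0 = (1 - t) *: (coord c x - u0).
    rewrite /z -/u0 -(opprB (coord c x) u0) scalerN scalerBl scale1r.
    by rewrite addrAC.
  rewrite normrZ ger0_norm ?subr_ge0// (le_lt_trans _ xr)// ler_piMl//.
  by rewrite gerBl.
move=> iz Hz; split=> //; set v := coord c x0 - coord c x.
have vn : gnorm G v <= e / 2.
  have -> : gnorm G v = gnorm G (coord c x - u0).
    by rewrite -[v]opprB -scaleN1r gnormZ normrN1 mul1r.
  exact: xn.
have := Hz v v; rewrite mul1r ler_distl -expr2 => /andP[_].
rewrite -(sqr_gnorm v (posdef_psd (posdef_gmx iz))) -(sqr_gnorm v (posdef_psd pG)).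
have := gnorm_ge0 G v; have := gnorm_ge0 (gmx c z) v.
move: vn; move: (gnorm G v) (gnorm (gmx c z) v) => p q; nra.
Unshelve. all: by end_near. Qed.

(** * Choice of constants and conclusion *)

Lemma rdist_set_ge0 (R : realType) (n : nat) (M : riemannianManifold R n)
    (x : M) (S : set M) : (0 <= rdist_set x S)%E.
Proof. by apply: le_ereal_inf_tmp => _ [y _ <-]; exact: rdist_ge0. Qed.

(** For e <= 1 one has (1 + e)^3 <= 1 + 7 e and (1 + e)^4 <= 16, so the two errors are at most e (7
    L + 8) and e (7 |mu_flat| + 32). The absolute value is there because [mu_flat] may be
    negative. *)
Lemma error_bound_constants (R : realType) (mu mu_flat L lambda_sharp : R) :
    0 <= L -> L < lambda_sharp -> mu_flat < mu ->
  exists2 e, 0 < e & (L + e) * (1 + e) ^+ 3 <= lambda_sharp /\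
    mu_flat * (1 + e) ^+ 3 + 2 * e * (1 + e) ^+ 4 <= mu.
Proof.
move=> L0 Ll mm.
pose e1 := (lambda_sharp - L) / (7 * L + 8).
pose e2 := (mu - mu_flat) / (32 + 7 * `|mu_flat|).
have d1 : 0 < 7 * L + 8 by lra.
have d2 : 0 < 32 + 7 * `|mu_flat| by have := normr_ge0 mu_flat; lra.
have e10 : 0 < e1 by rewrite divr_gt0// subr_gt0.
have e20 : 0 < e2 by rewrite divr_gt0// subr_gt0.
pose e := Num.min 1 (Num.min e1 e2).
have e0 : 0 < e by rewrite !lt_min ltr01 e10 e20.
have e_1 : e <= 1 by rewrite ge_min lexx.
have He1 : e * (7 * L + 8) <= lambda_sharp - L.
  by rewrite -ler_pdivlMr// !ge_min lexx !orbT.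
have He2 : e * (32 + 7 * `|mu_flat|) <= mu - mu_flat.
  by rewrite -ler_pdivlMr// !ge_min lexx !orbT.
exists e => //; clearbody e.
have c3 : 1 <= (1 + e) ^+ 3 <= 1 + 7 * e by apply/andP; split; nra.
have c4 : (1 + e) ^+ 4 <= 16.
  have : (1 + e) ^+ 2 <= 4 by nra.
  have : 0 <= (1 + e) ^+ 2 by exact: sqr_ge0.
  have -> : (1 + e) ^+ 4 = (1 + e) ^+ 2 * (1 + e) ^+ 2 by rewrite -exprD.
  nra.
move: ((1 + e) ^+ 3) c3 ((1 + e) ^+ 4) c4 => c /andP[c0 c1] p p1; split.
  apply: (@le_trans _ _ ((L + e) * (1 + 7 * e))); first by rewrite ler_wpM2l; lra.
  nra.
have : mu_flat * (c - 1) <= `|mu_flat| * (7 * e).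
  apply: (@le_trans _ _ (`|mu_flat| * (c - 1))).
    by rewrite ler_wpM2r ?ler_norm//; lra.
  by rewrite ler_wpM2l//; lra.
have : e * p <= e * 16 by rewrite ler_wpM2l// ltW.
lra.
Qed.

Lemma le_at_right0 (R : realType) (g : R -> R) (b e : R) : 0 < e ->
  {for 0, continuous g} -> (forall t, 0 < t <= e -> b <= g t) -> b <= g 0.
Proof.
move=> e0 cg bg; rewrite leNgt; apply/negP => gb.
have /cvg_within_filter/cvgr_lt/(_ _ gb) : g @ (0 : R) --> g 0 by exact: cg.
move=> /(_ (fun t => 0 < t)) N.
have [t [tb /andP[t0 te]]] : exists t, g t < b /\ 0 < t <= e.
  near (0 : R)^'+ => t; exists t; split; first by near: t; exact: N.
  apply/andP; split; near: t; first exact: nbhs_right_gt.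
  exact: nbhs_right_le.
by move: tb; rewrite ltNge bg// t0.
Unshelve. all: by end_near. Qed.

(** Cauchy-Schwarz for H itself. Positivity is essential: the largest eigenvalue of an indefinite
    form does not control its absolute value. *)
Lemma bform_le_psd (R : realType) (n : nat) (G H : 'M[R]_n) (L : R) :
    H^T = H -> (forall v, 0 <= bform H v v) -> 0 <= L ->
    (forall v, bform H v v <= L * bform G v v) ->
  forall v w, `|bform H v w| <= L * (gnorm G v * gnorm G w).
Proof.
move=> sH pH L0 HL v w; rewrite (le_trans (bform_le_gnorm _ _ sH pH))//.
have K z : gnorm H z <= Num.sqrt L * gnorm G z.
  by rewrite /gnorm -sqrtrM// ler_wsqrtr.
rewrite (le_trans (ler_pM (gnorm_ge0 _ _) (gnorm_ge0 _ _) (K v) (K w)))//.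
by rewrite mulrACA -expr2 sqr_sqrtr.
Qed.

(** The tolerance gives the factor a^-2 below exactly; above it gives 2 - a^-2, which is at most a^2
    because a^2 - 2 + a^-2 is the square of (a^2 - 1) / a. *)
Lemma gnorm_close (R : realType) (n : nat) (G G' : 'M[R]_n) (a : R) v :
    1 < a -> (forall z, 0 <= bform G z z) -> (forall z, 0 <= bform G' z z) ->
    `|bform G' v v - bform G v v| <= (1 - (a ^+ 2)^-1) * (gnorm G v * gnorm G v) ->
  gnorm G v <= a * gnorm G' v /\ gnorm G' v <= a * gnorm G v.
Proof.
move=> a1 pG pG'; have a0 : 0 < a by rewrite (lt_trans ltr01).
rewrite -expr2 -!sqr_gnorm// ler_distl => /andP[lo up].
have a2 : 0 < a ^+ 2 by rewrite exprn_gt0.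
split; rewrite -(ler_pXn2r (ltn0Sn 1)) ?nnegrE ?gnorm_ge0 ?mulr_ge0 ?gnorm_ge0 ?(ltW a0)//;
    rewrite exprMn.
  by rewrite -ler_pdivrMl// mulrC; move: lo; rewrite mulrBl mul1r opprB addrC subrK mulrC.
rewrite (le_trans up)// -[X in X + _]mul1r -mulrDl ler_wpM2r ?sqr_ge0//.
have : 0 <= (a ^+ 2 - 1) ^+ 2 / a ^+ 2 by rewrite divr_ge0 ?sqr_ge0// ltW.
have -> : (a ^+ 2 - 1) ^+ 2 / a ^+ 2 = a ^+ 2 - 2 + (a ^+ 2)^-1.
  by field; rewrite gt_eqF.
lra.
Qed.

Theorem proposition2p8 (R : realType) (n : nat) (M : riemannianManifold R n)
  (f : M -> R) (f_C2 : classC 2 f)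
  (xbar : M) (xbar_min : is_local_min f xbar)
  (mu : R) (mu_gt0 : 0 < mu)
  (quadratic_growth : \forall x \near xbar,
     ((mu / 2)%:E * rdist_set x (local_min_set f xbar) ^+ 2
        <= (f x - f xbar)%:E)%E) :
  forall mu_flat lambda_sharp : R,
    mu_flat < mu -> lambda_max (hess f xbar) < lambda_sharp ->
    exists U : set M, nbhs xbar U /\
      forall x, U x ->
        (mu_flat%:E * rdist_set x (local_min_set f xbar)
           <= (tangent_norm x (grad f x))%:E /\
         (tangent_norm x (grad f x))%:E
           <= lambda_sharp%:E * rdist_set x (local_min_set f xbar))%E.
Proof.
move=> mu_flat lambda_sharp mu_lt lambda_lt.
pose S := local_min_set f xbar; pose c := chart_at xbar.
pose u0 := coord c xbar; pose F := f \o param c.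
pose G := gmx c u0; pose H := hessian F u0; pose L := lambda_max (hess f xbar).
have cx0 : dom c xbar by exact: chart_atP.
have iu0 : image_of c u0 by exact: image_of_coord.
have iop : open (image_of c) by exact: image_of_open.
have pG : posdef G by exact: posdef_gmx.
have G_psd := posdef_psd pG.
have sG : G^T = G by exact: gmx_sym.
have F_min := local_min_coord cx0 xbar_min.
have crit z : 'D_z F u0 = 0 by exact: (local_min_derive iop (f_C2 c) iu0 F_min z).
have sH : H^T = H by exact: (hessian_sym iop (f_C2 c)).
have pH v : 0 <= bform H v v by exact: (local_min_hessian_ge0 iop (f_C2 c) iu0 F_min v).
have LE : L = lambda_max (H *m invmx G) by rewrite /L hess_critical.
have [L0 HL] := lambda_max_rayleigh sG pG sH pH; rewrite -LE in L0 HL.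
have H_le := bform_le_psd sH pH L0 HL.
have [m m0 G_lower] := posdef_lower_bound pG.
have [e e0 [e_sharp e_flat]] := error_bound_constants L0 lambda_lt mu_lt.
pose a := 1 + e; have a1 : 1 < a by rewrite ltrDl.
have a0 : 0 < a by rewrite (lt_trans ltr01).
have tau0 : 0 < 1 - (a ^+ 2)^-1.
  by rewrite subr_gt0 invf_lt1 ?exprn_gt0// exprn_egt1.
have [r r0 ball_bound] : exists2 r, 0 < r & forall z, `|z - u0| <= 2 * r ->
  [/\ image_of c z,
      forall v, gnorm G v <= a * gnorm (gmx c z) v,
      forall v, gnorm (gmx c z) v <= a * gnorm G v &
      forall v w, `|bform (hessian F z) v w - bform H v w| <=
                  e * (gnorm G v * gnorm G w)].
  have := @filterI _ (nbhs u0) (nbhs_filter u0) _ _ (near_image_of iu0)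
    (@filterI _ (nbhs u0) (nbhs_filter u0) _ _ (near_bform_close pG (gmx_continuous iu0) tau0)
      (near_bform_close pG (hessian_continuous (f_C2 c) iu0) e0)).
  move=> /nbhs_normP[r /= r0 rP]; exists (r / 3) => [|z zr]; first by rewrite divr_gt0.
  have [|iz [gz hz]] := rP z; first by rewrite /= distrC (le_lt_trans zr)//; lra.
  have gc v := gnorm_close a1 G_psd (posdef_psd (posdef_gmx iz)) (gz v v).
  by split=> // v; have [] := gc v.
(* The denominator 8 a makes the smallness condition hold for D = d + t with both d and t at most
   [eta]. *)
pose eta := (1 - a^-1) * (m * r) / (8 * a).
have k0 : 0 < 1 - a^-1 by rewrite subr_gt0 invf_lt1.
have eta0 : 0 < eta by rewrite divr_gt0 ?mulr_gt0.
exists [set x | [/\ dom c x, `|coord c x - u0| <= r, (rdist x xbar <= eta%:E)%E &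
  ((mu / 2)%:E * rdist_set x S ^+ 2 <= (f x - f xbar)%:E)%E]]; split.
  have cc : {for xbar, continuous (coord c)} by exact: coord_continuous.
  near=> x; split; near: x; [exact: near_dom| |exact: rdist_near|exact: quadratic_growth].
  by move/cvgr_distC_le : cc; apply.
move=> x [cx xr xeta QG]; set N := tangent_norm x (grad f x); rewrite -/S.
have N0 : 0 <= N by exact: sqrtr_ge0.
(* This membership makes the distance to S finite and small, so that the rest is real arithmetic. *)
have xbarS : S xbar by [].
have deta : (rdist_set x S <= eta%:E)%E.
  by rewrite (le_trans _ xeta)//; apply: ereal_inf_lbound; exists xbar.
have dfin : rdist_set x S \is a fin_num.
  by rewrite ge0_fin_numE ?rdist_set_ge0// (le_lt_trans deta)// ltry.
have [d dE] : exists d, rdist_set x S = d%:E by exists (fine (rdist_set x S)); rewrite fineK.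
have d0 : 0 <= d by rewrite -lee_fin -dE rdist_set_ge0.
have d_eta : d <= eta by rewrite -lee_fin -dE.
have est t : 0 < t <= eta -> N <= (L + e) * a ^+ 3 * (d + t) /\
    mu * d ^+ 2 <= N * a ^+ 3 * (d + t) + 2 * e * (a ^+ 2 * (d + t)) ^+ 2.
  move=> /andP[t0 te].
  (* The infimum need not be attained, hence the slack t; f y = f xbar lets quadratic growth at x be
     used with y. *)
  have [_ [y [ymin yf] <-]] := lb_ereal_inf_adherent t0 dfin.
  rewrite -/(rdist_set x S) dE -EFinD => /ltW xy.
  have Dr : 4 * a * (d + t) <= (1 - a^-1) * (m * r).
    have -> : (1 - a^-1) * (m * r) = 4 * a * (eta + eta).
      by rewrite /eta; field; rewrite gt_eqF.
    by rewrite ler_pM2l ?mulr_gt0// lerD.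
  have [A B] := critical_point_estimates f_C2 sG pG m0 G_lower r0 a1 (ltW e0) L0 H_le
    ball_bound cx xr ymin Dr xy.
  split=> //; apply: le_trans B; rewrite yf.
  move: QG; rewrite dE  -!EFinM lee_fin => QG.
  rewrite -(ler_pM2l (_ : 0 < 2^-1)) ?invr_gt0//; move: QG; lra.
(* Both bounds of [est] are polynomials in d + t, so t can be sent to 0 by continuity. *)
have lim_cst (P Q b : R) : (forall t, 0 < t <= eta -> b <= P * (d + t) + Q * (d + t) ^+ 2) ->
    b <= P * d + Q * d ^+ 2.
  move=> Hb; have := @le_at_right0 R (fun t => P * (d + t) + Q * (d + t) ^+ 2) b eta eta0 _ Hb.
  rewrite addr0; apply.
  apply: differentiable_continuous; apply/derivable1_diffP.
  by apply: derivableD; [apply: derivableM|apply: derivableM].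
have N_up : N <= (L + e) * a ^+ 3 * d.
  have := @lim_cst ((L + e) * a ^+ 3) 0 N.
  by rewrite !mul0r addr0; apply => t /est[]; rewrite mul0r addr0.
have N_lo : mu * d ^+ 2 <= N * a ^+ 3 * d + 2 * e * a ^+ 4 * d ^+ 2.
  apply: lim_cst => t /est[_]; rewrite exprMn -exprM.
  by rewrite (mulrA (2 * e)).
rewrite dE -!EFinM !lee_fin; split; last first.
  by rewrite (le_trans N_up)// ler_wpM2r.
(* [N_lo] is quadratic in d and is divided by d; at d = 0 the claim is just that the gradient norm
   is nonnegative. *)
have [d00|dp] := leP d 0.
  by have -> : d = 0 by [apply/eqP; rewrite eq_le d00]; rewrite mulr0.
have a30 : 0 < a ^+ 3 by rewrite exprn_gt0.
rewrite -(ler_pM2l a30) -(ler_pM2r dp).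
have : (mu_flat * a ^+ 3) * d ^+ 2 <= (mu - 2 * e * a ^+ 4) * d ^+ 2.
  by rewrite ler_wpM2r ?sqr_ge0// lerBrDr.
move: N_lo; rewrite -/a; move: (a ^+ 3) (a ^+ 4) => A3 A4; lra.
Unshelve. all: by end_near. Qed.
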